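(* Let $r$ be a positive integer and let $\Sigma$ be valid with $U_r(\Sigma)$ bounded. Let $Q\le G_r(\Sigma)$ be a finite subgroup and let $\pi(Q)=\{r_1,\ldots,r_t\}$. Then $$C_{G_r(\Sigma)}(Q)\cong H_{r_1}\times\cdots\times H_{r_t},$$ where each $H_{r_i}$ fits into a split group extension $$1\to K_i\to H_{r_i}\to G_{r_i}(\Sigma)\to 1$$ with $K_i$ locally finite.
   Context: Cantor algebras. Fix finitely many colours $\{1,\ldots,s\}$, each colour $i$ having an arity, an integer $n_i>1$. An $\Omega$-algebra is a set $U$ with, for each colour $i$, an $n_i$-ary operation $\lambda_i:U^{n_i}\to U$ and $n_i$ unary operations $\alpha_i^1,\ldots,\alpha_i^{n_i}:U\to U$ (operations act on the right); write $v\alpha_i=(v\alpha_i^1,\ldots,v\alpha_i^{n_i})$. For a subset $Y$, a simple expansion of colour $i$ replaces one element $y\in Y$ by the $n_i$ elements $y\alpha_i^1,\ldots,y\alpha_i^{n_i}$; a simple contraction of colour $i$ replaces $n_i$ distinct elements $a_1,\ldots,a_{n_i}$ of $Y$ by the single element $(a_1,\ldots,a_{n_i})\lambda_i$. Let $X$ be a finite set with $|X|=r$ and $W_\Omega(X)$ the free $\Omega$-algebra on $X$. A subset of $W_\Omega(X)$ (or of a quotient of it) is admissible if it is obtained from $X$ (or its image) by finitely many simple expansions and contractions. Let $\Sigma=\Sigma_1\cup\Sigma_2$, where $\Sigma_1$ consists of the laws $u\alpha_i\lambda_i=u$ and $(u_1,\ldots,u_{n_i})\lambda_i\alpha_i=(u_1,\ldots,u_{n_i})$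 for all colours $i$, and $\Sigma_2=\bigcup_{1\le i<i'\le s}\Sigma_2^{i,i'}$, where each $\Sigma_2^{i,i'}$ is either empty or is of the following form: for some maps $f:\{1,\ldots,n_i\}\to\{1,\ldots,s\}$ and $f':\{1,\ldots,n_{i'}\}\to\{1,\ldots,s\}$ put $\Lambda_i=\{\alpha_i^j\alpha_{f(j)}^k: 1\le j\le n_i,\,1\le k\le n_{f(j)}\}$ and $\Lambda_{i'}=\{\alpha_{i'}^j\alpha_{f'(j)}^k: 1\le j\le n_{i'},\,1\le k\le n_{f'(j)}\}$ (sets of length 2 sequences of descending operations), fix a bijection $\phi:\Lambda_i\to\Lambda_{i'}$, and let $\Sigma_2^{i,i'}$ be the set of laws $u\nu=u\phi(\nu)$, $\nu\in\Lambda_i$. The Cantor algebra $U_r(\Sigma)$ is the quotient of $W_\Omega(X)$ by the fully invariant congruence generated by $\Sigma$. $\Sigma$ (or $U_r(\Sigma)$) is valid if every admissible $Y\subseteq W_\Omega(X)$ has the same cardinality as its image in $U_r(\Sigma)$. In that case $U_r(\Sigma)$ is free on $X$ in the class of $\Omega$-algebras satisfying $\Sigma$, and every admissible subset is a basis. For admissible subsets $Y,Z$ of $U_r(\Sigma)$ write $Y\le Z$ if $Z$ is obtained from $Y$ by a finite number of simple expansions. The set $\mathfrak{A}_r(\Sigma)$ of admissible subsets of $U_r(\Sigma)$ is a poset under $\le$. $U_r(\Sigma)$ is bounded if for all admissible $B,C$ for which there is an admissible $A$ with $A\le B$ and $A\le C$, there is a unique least upper bound of $B$ and $C$, i.e.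 an admissible $T$ with $B\le T$, $C\le T$ and $T\le S$ for every admissible $S$ with $B\le S$, $C\le S$. $G_r(\Sigma)$ is the group of those $\Omega$-algebra automorphisms of $U_r(\Sigma)$ which are induced by a bijection $V\to W$ between admissible subsets of the same cardinality; it acts on the right on $\mathfrak{A}_r(\Sigma)$ by $Y\mapsto Yg$. For $Q\le G_r(\Sigma)$, $\mathfrak{A}_r(\Sigma)^Q$ is the set of admissible $Y$ with $Yq=Y$ for all $q\in Q$; such a $Y$ is a finite $Q$-set. For any integer $m\ge 1$, $U_m(\Sigma)$ and $G_m(\Sigma)$ denote the objects constructed in the same way, with the same colours, arities and laws, from a generating set of cardinality $m$; validity and boundedness are understood as properties holding for these algebras too. When $r_i=0$ the groups $G_{r_i}(\Sigma)$ and $H_{r_i}$ are understood to be trivial. The invariant $\pi(Q)$. Put $d=\gcd\{n_i-1: i=1,\ldots,s\}$. For a finite subgroup $Q$, list the isomorphism types of transitive $Q$-sets (transitive permutation representations of $Q$) as types $1,\ldots,t$. There is a unique tuple $\pi(Q)=\{r_1,\ldots,r_t\}$ of integers with $0\le r_j\le d$, indexed by the types, such that some $Y\in\mathfrak{A}_r(\Sigma)^Q$ has exactly $r_j$ orbits of type $j$ for each $j$. $C_G(Q)$ denotes the centraliser of $Q$ in $G$. A group is locally finite if all its finitely generated subgroups are finite. *)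

(* Defs.v *)
From HB Require Import structures.
From mathcomp Require Import all_boot.
From mathcomp Require Import boolp classical_sets functions cardinality.

Set Implicit Arguments.
Unset Strict Implicit.
Unset Printing Implicit Defensive.

Local Open Scope classical_set_scope.
Local Open Scope card_scope.
Local Open Scope quotient_scope.
Local Open Scope group_scope.

Record colours := Colours {
  ncol : nat;
  arity : 'I_ncol -> nat;
  arity_gt1 : forall i, (1 < arity i)%N }.

Record Oalg (K : colours) := OAlg {
  carrier :> Type;
  lam : forall i : 'I_(ncol K), ('I_(arity i) -> carrier) -> carrier;
  alp : forall i : 'I_(ncol K), 'I_(arity i) -> carrier -> carrier }.

Section Admissible.
Variables (K : colours) (A : Oalg K).

Definition simple_expansion (Y Z : set A) : Prop :=
  exists (i : 'I_(ncol K)) (y : A),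
    Y y /\ Z = (Y `\ y) `|` range (fun j : 'I_(arity i) => alp j y).

Definition simple_contraction (Y Z : set A) : Prop :=
  exists (i : 'I_(ncol K)) (a : 'I_(arity i) -> A),
    [/\ injective a, range a `<=` Y & Z = (Y `\` range a) `|` [set lam a]].

Inductive admissible (X : set A) : set A -> Prop :=
| adm_base : admissible X X
| adm_expansion Y Z :
    admissible X Y -> simple_expansion Y Z -> admissible X Z
| adm_contraction Y Z :
    admissible X Y -> simple_contraction Y Z -> admissible X Z.

(* expands Y Z is Y <= Z. *)
Inductive expands : set A -> set A -> Prop :=
| expands_refl Y : expands Y Y
| expands_step Y Z T : expands Y Z -> simple_expansion Z T -> expands Y T.

End Admissible.

Inductive term (K : colours) (X : Type) : Type :=
| Var of X
| Lam (i : 'I_(ncol K)) of ('I_(arity i) -> term K X)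
| Alp (i : 'I_(ncol K)) of 'I_(arity i) & term K X.
Arguments Var {K X} _.
Arguments Lam {K X} i _.
Arguments Alp {K X} i _ _.

HB.instance Definition _ (K : colours) (X : Type) := gen_eqMixin (term K X).
HB.instance Definition _ (K : colours) (X : Type) := gen_choiceMixin (term K X).

(* The absolutely free algebra W_Omega(X). *)
Definition free_alg (K : colours) (X : Type) : Oalg K :=
  @OAlg K (term K X) (@Lam K X) (@Alp K X).

Fixpoint subst (K : colours) (X Y : Type) (sigma : X -> term K Y)
    (w : term K X) : term K Y :=
  match w with
  | Var x => sigma x
  | Lam i f => Lam i (fun j => subst sigma (f j))
  | Alp i j v => Alp i j (subst sigma v)
  end.

(* A pair (j, k) stands for the sequence of descending operations
   alpha_i^j alpha_{f j}^k; distinct pairs are distinct sequences. *)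
Definition desc2 (K : colours) (i : 'I_(ncol K))
    (f : 'I_(arity i) -> 'I_(ncol K)) : Type :=
  {j : 'I_(arity i) & 'I_(arity (f j))}.

(* Operations act on the right, so alpha_i^j is applied first. *)
Definition apply2 (K : colours) (X : Type) (i : 'I_(ncol K))
    (f : 'I_(arity i) -> 'I_(ncol K)) (nu : desc2 f) (u : term K X) : term K X :=
  Alp (f (tag nu)) (tagged nu) (Alp i (tag nu) u).

Record coherence (K : colours) (i i' : 'I_(ncol K)) := Coherence {
  coh_f : 'I_(arity i) -> 'I_(ncol K);
  coh_f' : 'I_(arity i') -> 'I_(ncol K);
  coh_phi : desc2 coh_f -> desc2 coh_f';
  coh_bij : bijective coh_phi }.

(* [None] means that Sigma_2^{i,i'} is empty; only the values at i < i' are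
   ever used. *)
Definition laws2 (K : colours) : Type :=
  forall i i' : 'I_(ncol K), option (coherence i i').

(* The laws are pairs of terms in the variables Var 0, Var 1, ... *)
Inductive Sigma (K : colours) (S2 : laws2 K) : term K nat -> term K nat -> Prop :=
| law_alp_lam (i : 'I_(ncol K)) :
    Sigma S2 (Lam i (fun j => Alp i j (Var 0%N))) (Var 0%N)
| law_lam_alp (i : 'I_(ncol K)) (j : 'I_(arity i)) :
    Sigma S2 (Alp i j (Lam i (fun k => Var (nat_of_ord k))))
             (Var (nat_of_ord j))
| law_coh (i i' : 'I_(ncol K)) (c : coherence i i') (nu : desc2 (coh_f c)) :
    (i < i')%N -> S2 i i' = Some c ->
    Sigma S2 (apply2 nu (Var 0%N)) (apply2 (coh_phi nu) (Var 0%N)).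

(* The fully invariant congruence generated by Sigma: the congruence generated
   by all substitution instances of the laws. It is closed under endomorphisms,
   see [cong_subst]. *)
Inductive cong (K : colours) (S2 : laws2 K) (X : Type) :
    term K X -> term K X -> Prop :=
| cong_law l l' (sigma : nat -> term K X) :
    Sigma S2 l l' -> cong S2 (subst sigma l) (subst sigma l')
| cong_refl v : cong S2 v v
| cong_sym v w : cong S2 v w -> cong S2 w v
| cong_trans v w z : cong S2 v w -> cong S2 w z -> cong S2 v z
| cong_lam (i : 'I_(ncol K)) (f g : 'I_(arity i) -> term K X) :
    (forall j, cong S2 (f j) (g j)) -> cong S2 (Lam i f) (Lam i g)
| cong_alp (i : 'I_(ncol K)) (j : 'I_(arity i)) v w :
    cong S2 v w -> cong S2 (Alp i j v) (Alp i j w).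

Lemma subst_subst (K : colours) (X Y Z : Type) (sigma : X -> term K Y)
    (tau : Y -> term K Z) (w : term K X) :
  subst tau (subst sigma w) = subst (fun x => subst tau (sigma x)) w.
Proof.
elim: w => [x|i f IH|i j v IH] //=; last by rewrite IH.
by congr Lam; apply/funext => j; apply: IH.
Qed.

Lemma cong_subst (K : colours) (S2 : laws2 K) (X Y : Type)
    (tau : X -> term K Y) (v w : term K X) :
  cong S2 v w -> cong S2 (subst tau v) (subst tau w).
Proof.
elim=> {v w} [l l' sigma H|v|v w _ IH|v w z _ IH1 _ IH2|i f g _ IH|i j v w _ IH] /=.
- by rewrite !subst_subst; apply: cong_law.
- exact: cong_refl.
- exact: cong_sym.
- exact: cong_trans IH1 IH2.
- exact: cong_lam.
- exact: cong_alp.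
Qed.

Section Cantor.
Variables (K : colours) (S2 : laws2 K) (r : nat).

Definition congb : rel (term K 'I_r) := fun v w => `[< cong S2 v w >].

Lemma congb_equiv : equiv_class_of congb.
Proof.
split=> [v|v w|w v z].
- by apply/asboolP; apply: cong_refl.
- by apply/asboolP/asboolP; apply: cong_sym.
- by move=> /asboolP vw /asboolP wz; apply/asboolP; apply: cong_trans vw wz.
Qed.

Canonical congb_equivRel := EquivRelPack congb_equiv.

Definition cantor_type := {eq_quot congb_equivRel}.

Definition cantor_pi (w : term K 'I_r) : cantor_type := \pi_cantor_type w.

Definition cantor : Oalg K :=
  @OAlg K cantor_type
    (fun i f => cantor_pi (Lam i (fun j => repr (f j))))
    (fun i j u => cantor_pi (Alp i j (repr u))).

Lemma cantor_piE (v w : term K 'I_r) :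
  cantor_pi v = cantor_pi w <-> cong S2 v w.
Proof.
by split=> [/eqmodP/asboolP|vw]; last exact/eqmodP/asboolP.
Qed.

Lemma cantor_pi_lam (i : 'I_(ncol K)) (f : 'I_(arity i) -> term K 'I_r) :
  cantor_pi (Lam i f) = @lam K cantor i (fun j => cantor_pi (f j)).
Proof.
by apply/cantor_piE/cong_lam => j; apply/cantor_piE; rewrite /cantor_pi reprK.
Qed.

Lemma cantor_pi_alp (i : 'I_(ncol K)) (j : 'I_(arity i)) (v : term K 'I_r) :
  cantor_pi (Alp i j v) = @alp K cantor i j (cantor_pi v).
Proof.
by apply/cantor_piE/cong_alp/cantor_piE; rewrite /cantor_pi reprK.
Qed.

Definition W_admissible : set (set (free_alg K 'I_r)) :=
  admissible (A := free_alg K 'I_r) (range Var).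

Definition U_admissible : set (set cantor) :=
  admissible (A := cantor) (range (fun x : 'I_r => cantor_pi (Var x))).

Definition valid : Prop :=
  forall Y : set (term K 'I_r), W_admissible Y -> Y #= cantor_pi @` Y.

Definition is_lub (B C T : set cantor) : Prop :=
  [/\ U_admissible T, expands B T, expands C T &
      forall S, U_admissible S -> expands B S -> expands C S -> expands T S].

Definition bounded : Prop :=
  forall B C : set cantor, U_admissible B -> U_admissible C ->
    (exists A, [/\ U_admissible A, expands A B & expands A C]) ->
    exists! T, is_lub B C T.

End Cantor.

Section Aut.
Variables (K : colours) (A : Oalg K).

Record aut := Aut {
  aut_fun :> A -> A;
  aut_inv : A -> A;
  aut_funK : cancel aut_fun aut_inv;
  aut_invK : cancel aut_inv aut_fun;
  aut_lam : forall (i : 'I_(ncol K)) (a : 'I_(arity i) -> A),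
    aut_fun (lam a) = lam (fun j => aut_fun (a j));
  aut_alp : forall (i : 'I_(ncol K)) (j : 'I_(arity i)) (u : A),
    aut_fun (alp j u) = alp j (aut_fun u) }.

Lemma aut_eq (g h : aut) : (forall u, g u = h u) -> g = h.
Proof.
case: g h => [f g fK gK fl fa] [f' g' fK' gK' fl' fa'] /= E.
have Ef : f = f' by apply/funext.
subst f'; have Eg : g = g' by apply/funext => u; rewrite -{1}[u]gK' fK.
by subst g'; congr Aut; apply: Prop_irrelevance.
Qed.

Definition aut_one : aut :=
  @Aut id id (fun=> erefl) (fun=> erefl) (fun _ _ => erefl) (fun _ _ _ => erefl).

#[local] Obligation Tactic := idtac.

(* Automorphisms act on the right: g * h is g followed by h. *)
Program Definition aut_mul (g h : aut) : aut :=
  @Aut (fun u => h (g u)) (fun u => aut_inv g (aut_inv h u)) _ _ _ _.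
Next Obligation. by move=> g h u; rewrite !aut_funK. Qed.
Next Obligation. by move=> g h u; rewrite !aut_invK. Qed.
Next Obligation. by move=> g h i a /=; rewrite !aut_lam. Qed.
Next Obligation. by move=> g h i j u /=; rewrite !aut_alp. Qed.

Program Definition aut_opp (g : aut) : aut :=
  @Aut (aut_inv g) g (@aut_invK g) (@aut_funK g) _ _.
Next Obligation.
move=> g i a; apply: (can_inj (@aut_funK g)); rewrite aut_lam aut_invK.
by congr lam; apply/funext => j; rewrite aut_invK.
Qed.
Next Obligation.
by move=> g i j u; apply: (can_inj (@aut_funK g)); rewrite aut_alp !aut_invK.
Qed.

HB.instance Definition _ := gen_eqMixin aut.
HB.instance Definition _ := gen_choiceMixin aut.

Lemma aut_mulA : associative aut_mul.
Proof. by move=> f g h; apply: aut_eq. Qed.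
Lemma aut_mul1 : left_id aut_one aut_mul.
Proof. by move=> g; apply: aut_eq. Qed.
Lemma aut_mulr1 : right_id aut_one aut_mul.
Proof. by move=> g; apply: aut_eq. Qed.
Lemma aut_mulV : left_inverse aut_one aut_opp aut_mul.
Proof. by move=> g; apply: aut_eq => u /=; rewrite aut_invK. Qed.
Lemma aut_mulrV : right_inverse aut_one aut_opp aut_mul.
Proof. by move=> g; apply: aut_eq => u /=; rewrite aut_funK. Qed.

HB.instance Definition _ :=
  isGroup.Build aut aut_mulA aut_mul1 aut_mulr1 aut_mulV aut_mulrV.

End Aut.

(* Subgroups of a [groupType] are given as classical sets. *)
Definition subgroup (gT : groupType) (S : set gT) : Prop :=
  group_closed [in S].

Definition centraliser (gT : groupType) (G Q : set gT) : set gT :=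
  [set g | G g /\ forall q, Q q -> commute g q].

Definition locally_finite (gT : groupType) : Prop :=
  forall S : set gT, finite_set S -> finite_set (smallest (@subgroup gT) S).

Section Dprod.
Variables (t : nat) (H : 'I_t -> groupType).

Definition dprod_group : Type := forall i, H i.

HB.instance Definition _ := gen_eqMixin dprod_group.
HB.instance Definition _ := gen_choiceMixin dprod_group.

Let one : dprod_group := fun=> 1.
Let mul (x y : dprod_group) : dprod_group := fun i => x i * y i.
Let inv (x : dprod_group) : dprod_group := fun i => (x i)^-1.

Fact dprod_mulA : associative mul.
Proof. by move=> x y z; apply: functional_extensionality_dep => i; apply: mulgA. Qed.
Fact dprod_mul1 : left_id one mul.
Proof. by move=> x; apply: functional_extensionality_dep => i; apply: mul1g. Qed.
Fact dprod_mulr1 : right_id one mul.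
Proof. by move=> x; apply: functional_extensionality_dep => i; apply: mulg1. Qed.
Fact dprod_mulV : left_inverse one inv mul.
Proof. by move=> x; apply: functional_extensionality_dep => i; apply: mulVg. Qed.
Fact dprod_mulrV : right_inverse one inv mul.
Proof. by move=> x; apply: functional_extensionality_dep => i; apply: mulgV. Qed.

HB.instance Definition _ := isGroup.Build dprod_group
  dprod_mulA dprod_mul1 dprod_mulr1 dprod_mulV dprod_mulrV.

End Dprod.

Definition isomorphic_to (gT : groupType) (S : set gT) (hT : groupType) : Prop :=
  exists f : gT -> hT,
    (forall x y, S x -> S y -> f (x * y) = f x * f y) /\ set_bij S setT f.

(* 1 -> kT -> hT -> G -> 1 is a split extension, G being a subgroup of gT. *)
Definition split_extension (kT hT gT : groupType) (G : set gT) : Prop :=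
  exists (iota : {multiplicative kT -> hT}) (p : {multiplicative hT -> gT})
         (sec : gT -> hT),
    [/\ injective iota,
        forall h, p h = 1 <-> range iota h,
        range p = G,
        forall x y, G x -> G y -> sec (x * y) = sec x * sec y &
        forall x, G x -> p (sec x) = x].

Section QSets.
Variables (gT : groupType) (Q : set gT).

(* Right Q-sets; [qact x q] is meaningful for q in Q only. *)
Record qset := QSet {
  qset_car :> Type;
  qact : qset_car -> gT -> qset_car;
  qact1 : forall x, qact x 1 = x;
  qactM : forall x q q', Q q -> Q q' -> qact x (q * q') = qact (qact x q) q' }.

Definition transitive_qset (S : qset) : Prop :=
  (exists x : S, True) /\ forall x y : S, exists2 q, Q q & qact x q = y.

Definition qset_iso (S T : qset) : Prop :=
  exists2 b : S -> T, bijective b & forall x q, Q q -> b (qact x q) = qact (b x) q.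

(* T lists every isomorphism type of transitive Q-sets exactly once. *)
Definition transitive_types (t : nat) (T : 'I_t -> qset) : Prop :=
  [/\ forall j, transitive_qset (T j),
      forall j k, qset_iso (T j) (T k) -> j = k &
      forall S, transitive_qset S -> exists j, qset_iso S (T j)].

End QSets.

Section CantorGroup.
Variables (K : colours) (S2 : laws2 K) (r : nat).

(* For r = 0 the algebra is empty and this is the trivial group. *)
Definition cantor_group : set (aut (cantor S2 r)) :=
  [set g | exists V W : set (cantor S2 r),
     [/\ U_admissible V, U_admissible W, V #= W & set_bij V W g]].

Definition colour_gcd : nat := \big[gcdn/0%N]_(i < ncol K) (arity i).-1.

Variable Q : set (aut (cantor S2 r)).

Definition Q_fixed (Y : set (cantor S2 r)) : Prop :=
  forall q : aut (cantor S2 r), Q q -> q @` Y = Y.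

Definition orbit_of (y : cantor S2 r) : set (cantor S2 r) :=
  [set q y | q in Q].

Definition has_type (O : set (cantor S2 r)) (T : qset Q) : Prop :=
  exists b : T -> cantor S2 r,
    set_bij setT O b /\
    forall x (q : aut (cantor S2 r)), Q q -> b (qact x q) = q (b x).

Definition orbits_of_type (Y : set (cantor S2 r)) (T : qset Q) :
    set (set (cantor S2 r)) :=
  [set O | (exists2 y, Y y & O = orbit_of y) /\ has_type O T].

(* pi(Q) = {rr_0, ..., rr_(t-1)}, relative to the list T of types. *)
Definition is_pi (t : nat) (T : 'I_t -> qset Q) (rr : 'I_t -> nat) : Prop :=
  (forall j, (rr j <= colour_gcd)%N) /\
  exists Y, [/\ U_admissible Y, Q_fixed Y &
                forall j, orbits_of_type Y (T j) #= `I_(rr j)].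

End CantorGroup.

(* Main.v *)
(* A Q-fixed admissible set Y splits into parts Y_j, the union of the orbits of
   type j. An element of the centraliser maps some Q-fixed expansion V of Y onto
   another one; since automorphisms fix the descendants of their fixed points, a
   descendant of y in Y has the same stabiliser as y, so types are preserved and
   the subalgebra generated by each Y_j is invariant. Hence the centraliser is
   the direct product of its subgroups H_j of elements that fix Y outside Y_j.

   Choosing r_j orbit representatives with a common stabiliser in Y_j embeds
   U_{r_j} by iota, with retraction pi identifying Q-translates. Then
   h |-> pi h iota is a homomorphism H_j -> G_{r_j}, split by the Q-equivariant
   extension of iota g. An element of the kernel maps every v in a suitable
   expansion V to some vq; finitely many such elements share a common V, and
   those with this property for one finite V form a finite group. *)
Require Import Defs.
From HB Require Import structures.
From mathcomp Require Import all_boot.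
From mathcomp Require Import boolp classical_sets functions cardinality.

Set Implicit Arguments.
Unset Strict Implicit.
Unset Printing Implicit Defensive.

Local Open Scope classical_set_scope.
Local Open Scope card_scope.
Local Open Scope group_scope.

(** * Homomorphisms, descendants and expansions *)

Section Algebra.
Variable K : colours.
Implicit Types A B C : Oalg K.

Definition is_hom A B (f : A -> B) : Prop :=
  (forall (i : 'I_(ncol K)) (a : 'I_(arity i) -> A),
     f (lam a) = lam (fun j => f (a j))) /\
  (forall (i : 'I_(ncol K)) (j : 'I_(arity i)) u, f (alp j u) = alp j (f u)).

Inductive desc A (y : A) : A -> Prop :=
| desc_refl : desc y y
| desc_alp (i : 'I_(ncol K)) (j : 'I_(arity i)) u :
    desc y u -> desc y (alp j u).

Inductive gen A (S : set A) : A -> Prop :=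
| gen_in u : S u -> gen S u
| gen_lam (i : 'I_(ncol K)) (a : 'I_(arity i) -> A) :
    (forall j, gen S (a j)) -> gen S (lam a)
| gen_alp (i : 'I_(ncol K)) (j : 'I_(arity i)) u : gen S u -> gen S (alp j u).

Definition descs A (S : set A) : set A := [set u | exists2 y, S y & desc y u].

Definition separated A (Y : set A) : Prop :=
  forall y y' u, Y y -> Y y' -> desc y u -> desc y' u -> y = y'.

Lemma hom_id A : is_hom (@id A). Proof. by []. Qed.

Lemma hom_comp A B C (f : A -> B) (g : B -> C) :
  is_hom f -> is_hom g -> is_hom (g \o f).
Proof.
by move=> [fl fa] [gl ga]; split=> [i a|i j u] /=; rewrite ?fl ?gl ?fa ?ga.
Qed.

Lemma hom_aut A (g : aut A) : is_hom g.
Proof. by split; [exact: aut_lam|exact: aut_alp]. Qed.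

Lemma hom_desc A B (f : A -> B) y u :
  is_hom f -> desc y u -> desc (f y) (f u).
Proof.
move=> [_ fa]; elim=> [|i j v _ IH]; first exact: desc_refl.
by rewrite fa; apply: desc_alp.
Qed.

Lemma hom_gen A B (f : A -> B) (S : set A) (T : set B) u : is_hom f ->
  (forall v, S v -> gen T (f v)) -> gen S u -> gen T (f u).
Proof.
move=> [fl fa] ST; elim=> {u} [u /ST//|i a _ IH|i j u _ IH].
  by rewrite fl; apply: gen_lam.
by rewrite fa; apply: gen_alp.
Qed.

Lemma gen_sub A (S T : set A) u :
  (forall v, S v -> gen T v) -> gen S u -> gen T u.
Proof. exact: (hom_gen (@hom_id A)). Qed.

Lemma hom_eq_gen A B (f g : A -> B) (S : set A) u : is_hom f -> is_hom g ->
  (forall v, S v -> f v = g v) -> gen S u -> f u = g u.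
Proof.
move=> [fl fa] [gl ga] E; elim=> {u} [u /E//|i a _ IH|i j u _ IH].
  by rewrite fl gl; congr lam; apply/funext.
by rewrite fa ga IH.
Qed.

Lemma hom_eq_desc A B (f g : A -> B) y u : is_hom f -> is_hom g ->
  f y = g y -> desc y u -> f u = g u.
Proof. by move=> [_ fa] [_ ga] E; elim=> // i j v _; rewrite fa ga => ->. Qed.

Lemma desc_trans A (x y z : A) : desc x y -> desc y z -> desc x z.
Proof. by move=> xy; elim=> // i j u _; apply: desc_alp. Qed.

Lemma desc_gen A (S : set A) y u : S y -> desc y u -> gen S u.
Proof. by move=> Sy; elim=> [|i j v _]; [apply: gen_in|apply: gen_alp]. Qed.

Lemma expands_trans A (X Y Z : set A) :
  expands X Y -> expands Y Z -> expands X Z.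
Proof.
by move=> + YZ; elim: YZ => // {Y Z} Y Z T _ IH ZT /IH XZ; apply: expands_step ZT.
Qed.

Lemma expands_desc A (Y Z : set A) z : expands Y Z -> Z z -> descs Y z.
Proof.
move=> YZ; elim: YZ z => {Y Z} [Y z Yz|Y Z T _ IH [i [y [Zy ->]]] z].
  by exists z => //; apply: desc_refl.
case=> [[/IH//]|[j _ <-]]; have [x Yx xy] := IH _ Zy.
by exists x => //; apply: desc_alp.
Qed.

Lemma descs_expands A (X Y : set A) : expands X Y -> descs Y `<=` descs X.
Proof.
move=> XY u [y Yy yu]; have [x Xx xy] := expands_desc XY Yy.
by exists x => //; apply: desc_trans yu.
Qed.

Lemma sub_descs A (S : set A) : S `<=` descs S.
Proof. by move=> y Sy; exists y => //; apply: desc_refl. Qed.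

(** Injectivity on [Y] keeps [f y] out of the image of the remaining elements. *)
Lemma image_simple_expansion A B (f : A -> B) (Y Z : set A) :
  is_hom f -> (forall u v, Y u -> Y v -> f u = f v -> u = v) ->
  simple_expansion Y Z -> simple_expansion (f @` Y) (f @` Z).
Proof.
move=> [_ fa] fI [i [y [Yy ->]]]; exists i, (f y); split; first by exists y.
apply/seteqP; split=> u.
  case=> v [[Yv vy] <-|[j _ <-] <-]; last by right; exists j; rewrite ?fa.
  by left; split; [exists v|move=> /fI E; apply: vy; apply: E].
case=> [[[v Yv <-] vy]|[j _ <-]].
  by exists v => //; left; split=> // E; apply: vy; rewrite E.
by exists (alp j y); [right; exists j|rewrite fa].
Qed.

(** Every intermediate set of the expansion consists of descendants of [Y], which is where
    injectivity is required. *)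
Lemma image_expands A B (f : A -> B) (Y Z : set A) : is_hom f ->
  (forall u v, descs Y u -> descs Y v -> f u = f v -> u = v) ->
  expands Y Z -> expands (f @` Y) (f @` Z).
Proof.
move=> fH + YZ; elim: YZ => {Y Z} [Y _|Y Z T YZ IH ZT fI].
  exact: expands_refl.
apply: (expands_step (IH fI)); apply: image_simple_expansion ZT => // u v Zu Zv.
by apply: fI; apply: descs_expands YZ _ _; apply: sub_descs.
Qed.

Lemma admissible_expands A (X Y Z : set A) :
  admissible X Y -> expands Y Z -> admissible X Z.
Proof.
by move=> + YZ; elim: YZ => // {Y Z} Y Z T _ IH ZT /IH XZ; apply: adm_expansion ZT.
Qed.

Lemma admissible_finite A (X Y : set A) :
  finite_set X -> admissible X Y -> finite_set Y.
Proof.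
move=> Xf; elim=> {Y} [//|Y Z _ Yf [i [y [_ ->]]]|Y Z _ Yf [i [a [_ _ ->]]]].
  rewrite finite_setU; split; first exact: finite_setD.
  by apply: finite_image; apply: finite_finset.
by rewrite finite_setU; split; [exact: finite_setD|exact: finite_set1].
Qed.

(** Disjointness of descendants ensures that an element expanded on the [X] side never lies in [R],
    so each step carries over to the union. *)
Lemma expands_setUr A (X Y R : set A) : descs X `&` descs R `<=` set0 ->
  expands X Y -> expands (X `|` R) (Y `|` R).
Proof.
move=> + XY; elim: XY => {X Y} [X _|X Z T XZ IH [i [z [Zz ->]]] D].
  exact: expands_refl.
apply: (expands_step (IH D)); exists i, z; split; first by left.
have zR : ~ R z.
  move=> Rz; apply: (D z); split; first exact: expands_desc XZ Zz.
  exact: sub_descs.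
apply/seteqP; split=> u.
  case=> [[[Zu uz]|Zu]|Ru]; first by left; split => //; left.
    by right.
  by left; split; [right|move=> E; apply: zR; rewrite -E].
by case=> [[[Zu|Ru] uz]|Zu]; [left; left|right|left; right].
Qed.

Lemma expands_setU A (X Y R S : set A) : descs X `&` descs R `<=` set0 ->
  expands X Y -> expands R S -> expands (X `|` R) (Y `|` S).
Proof.
move=> D XY RS; apply: expands_trans (expands_setUr D XY) _.
rewrite !(setUC Y); apply: expands_setUr RS => u [Ru Yu].
by apply: (D u); split=> //; apply: descs_expands XY _ Yu.
Qed.

(** The elements of [Y] are expanded one at a time; separation supplies the disjointness demanded by
    [expands_setU]. *)
Lemma expands_bigcup A (Y : set A) (F : A -> set A) :
  finite_set Y -> separated Y -> (forall y, Y y -> expands [set y] (F y)) ->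
  expands Y (\bigcup_(y in Y) F y).
Proof.
move=> [n]; elim: n Y => [|n IH] Y.
  rewrite II0 card_eq0 => /eqP -> _ _.
  by rewrite bigcup_set0; apply: expands_refl.
case/eq_cardSP => y Yy Yn sepY YF.
rewrite (bigcup_setD1 _ _ _ Yy) -{1}(setD1K Yy).
apply: expands_setU; last 2 first.
- exact: YF.
- by apply: IH => // [x x' u [Yx _] [Yx' _]|x [Yx _]]; [exact: sepY|exact: YF].
by move=> u [[_ -> yu] [x [Yx xy] xu]]; apply: xy; apply: sepY xu yu.
Qed.

(** A step at a descendant of [y] is repeated below [y]; any other step takes place below some [x]
    different from [y], so by separation it changes no descendant of [y]. *)
Lemma expands_restrict A (Y V : set A) y : separated Y -> expands Y V ->
  Y y -> expands [set y] (V `&` desc y).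
Proof.
move=> + YV; elim: YV => {V} [{}Y sepY Yy|{}Y Z T YZ IH [i [z [Zz ->]]] sepY Yy].
  rewrite (_ : Y `&` _ = [set y]); first exact: expands_refl.
  apply/seteqP; split=> u; last by move=> ->; split=> //; apply: desc_refl.
  by move=> [Yu yu]; apply/esym; apply: sepY yu (desc_refl u).
have {}IH := IH sepY Yy; have [x Yx xz] := expands_desc YZ Zz.
have [yz|yz] := pselect (desc y z).
  apply: (expands_step IH); exists i, z; split=> //.
  apply/seteqP; split=> u.
    by case=> [[[Zu uz]|Zu] yu]; [left|right].
  case=> [[[Zu yu] uz]|[j _ <-]]; first by split=> //; left.
  by split; [right; exists j|apply: desc_alp].
suff -> : (Z `\ z `|` range (fun j : 'I_(arity i) => alp j z)) `&` desc y
    = Z `&` desc y by [].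
apply/seteqP; split=> u.
  case=> [[[Zu uz]//|[j _ <-]]] yu; case: yz.
  by rewrite (sepY _ _ _ Yy Yx yu (desc_alp j xz)).
by move=> [Zu yu]; split=> //; left; split=> // E; apply: yz; rewrite -E.
Qed.

End Algebra.

(** * Models of the laws and bases *)

Fixpoint eval (K : colours) (X : Type) (A : Oalg K) (rho : X -> A)
    (w : term K X) : A :=
  match w with
  | Var x => rho x
  | Lam i f => lam (fun j => eval rho (f j))
  | Alp i j v => alp j (eval rho v)
  end.

Section Model.
Variables (K : colours) (S2 : laws2 K).
Implicit Types A B : Oalg K.

Definition model A : Prop :=
  forall l l', Sigma S2 l l' -> forall rho : nat -> A, eval rho l = eval rho l'.

Lemma eval_subst A (X Y : Type) (sigma : X -> term K Y) (rho : Y -> A) w :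
  eval rho (subst sigma w) = eval (fun x => eval rho (sigma x)) w.
Proof.
elim: w => [x|i f IH|i j v IH] //=; last by rewrite IH.
by congr lam; apply/funext.
Qed.

Lemma eval_cong A (X : Type) (rho : X -> A) v w :
  model A -> cong S2 v w -> eval rho v = eval rho w.
Proof.
move=> MA; elim=> {v w} [l l' sigma H|v|v w _ <-|v w z _ -> _ ->|i f g _ IH
  |i j v w _ IH] //=.
- by rewrite !eval_subst; apply: MA.
- by congr lam; apply/funext.
- by rewrite IH.
Qed.

Lemma alpK A (i : 'I_(ncol K)) (u : A) : model A ->
  lam (fun j : 'I_(arity i) => alp j u) = u.
Proof. by move=> MA; apply: (MA _ _ (law_alp_lam S2 i) (fun=> u)). Qed.

Lemma lamK A (i : 'I_(ncol K)) (a : 'I_(arity i) -> A) j : model A ->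
  alp j (lam a) = a j.
Proof.
(* Extends [a] to all variables; the default [a j] is taken only at indices beyond the arity, which
   do not occur in the law. *)
pose rho n := if insub n is Some k then a k else a j.
move=> /(_ _ _ (law_lam_alp S2 j) rho) /=.
have rhoE (k : 'I_(arity i)) : rho k = a k by rewrite /rho valK.
by rewrite rhoE => <-; congr alp; congr lam; apply/funext => k.
Qed.

(** An expanded element is recovered by contracting its children, by [alpK]. *)
Lemma gen_expands A (Y Z : set A) y : model A -> expands Y Z ->
  Y y -> gen Z y.
Proof.
move=> MA YZ; elim: YZ y => {Y Z} [Y y Yy|Y Z T _ IH [i [z [Zz ->]]] y Yy].
  exact: gen_in.
apply: gen_sub (IH _ Yy) => u Zu; have [->|uz] := pselect (u = z).
  by rewrite -[X in gen _ X](alpK i) //; apply: gen_lam => j; apply: gen_in; right; exists j.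
by apply: gen_in; left.
Qed.

(** Existence alone is required; uniqueness of the extension comes from generation, through
    [hom_eq_gen]. *)
Definition free_on A (Y : set A) : Prop :=
  forall B, model B -> forall f : A -> B,
    exists h : A -> B, is_hom h /\ forall y, Y y -> h y = f y.

Definition basis A (Y : set A) : Prop := free_on Y /\ forall u, gen Y u.

Lemma simple_expansion_basis A (Y Z : set A) : model A ->
  basis Y -> simple_expansion Y Z -> basis Z.
Proof.
move=> MA [freeY genY] [i [y [Yy EZ]]]; split=> [B MB f|u].
  (* Sending [y] to the contraction of the values wanted on its children realises those values, by
     [lamK]. *)
  pose f' u := if pselect (u = y) then lam (fun j : 'I_(arity i) => f (alp j y))
               else f u.
  have [h [hH hf]] := freeY B MB f'; exists h; split=> // z; rewrite EZ.
  case=> [[Yz zy]|[j _ <-]]; first by rewrite hf // /f'; case: pselect.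
  rewrite hH.2 hf // /f'; case: pselect => [e|/(_ erefl)[]] ; rewrite lamK //.
apply: gen_sub (genY u) => v; apply: gen_expands => //.
by apply: expands_step (expands_refl Y) _; exists i, y.
Qed.

Lemma simple_contraction_basis A (Y Z : set A) : model A ->
  basis Y -> simple_contraction Y Z -> basis Z.
Proof.
move=> MA [freeY genY] [i [a [aI aY EZ]]]; split=> [B MB f|u].
  (* Each [a j] is sent to the component of index [j] of the value wanted at [lam a]; injectivity of
     [a] makes the index unambiguous. *)
  pose f' u := if pselect (exists j, a j = u) is left E
               then alp (projT1 (cid E)) (f (lam a)) else f u.
  have f'a j : f' (a j) = alp j (f (lam a)).
    rewrite /f'; case: pselect => [E|[]]; last by exists j.
    by case: cid => k /= /aI ->.
  have [h [hH hf]] := freeY B MB f'; exists h; split=> // z; rewrite EZ.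
  case=> [[Yz za]|->].
    by rewrite hf // /f'; case: pselect => // -[j E]; case: za; exists j.
  rewrite hH.1 (_ : (fun j => _) = (fun j => alp j (f (lam a)))) ?alpK //.
  by apply/funext => j; rewrite hf ?f'a //; apply: aY; exists j.
apply: gen_sub (genY u) => v Yv; have [[j _ <-]|va] := pselect (range a v).
  by rewrite -(lamK a j) //; apply/gen_alp/gen_in; rewrite EZ; right.
by apply: gen_in; rewrite EZ; left.
Qed.

Lemma admissible_basis A (X Y : set A) : model A ->
  basis X -> admissible X Y -> basis Y.
Proof.
move=> MA bX; elim=> {Y} [//|Y Z _ bY YZ|Y Z _ bY YZ].
  exact: simple_expansion_basis YZ.
exact: simple_contraction_basis YZ.
Qed.

(** * Bases when some model has two distinct elements *)

Section Nontrivial.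
Variable B : Oalg K.
Hypothesis modelB : model B.
Variables b0 b1 : B.
Hypothesis b01 : b0 <> b1.

(* Every composite of descending operations is onto in a model, since
   alp j (lam (fun=> b)) = b. *)
Lemma desc_onto A (y u : A) b : desc y u ->
  exists c : B, forall h : A -> B, is_hom h -> h y = c -> h u = b.
Proof.
move=> yu; elim: yu b => {u} [b|i j u _ IH b]; first by exists b.
have [c hc] := IH (@lam K B i (fun=> b)); exists c => h hH hy.
by rewrite hH.2 (hc h) // lamK.
Qed.

(** Freeness allows distinct [y] and [y'] to be sent independently to elements that force [b0] and
    [b1] as the image of a common descendant. *)
Lemma basis_separated A (Y : set A) : basis Y -> separated Y.
Proof.
move=> [freeY _] y y' u Yy Yy' yu y'u; apply: contrapT => yy'.
have [c0 H0] := desc_onto b0 yu; have [c1 H1] := desc_onto b1 y'u.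
have [h [hH hf]] := freeY B modelB (fun v => if pselect (v = y) then c0 else c1).
apply: b01; rewrite -(H0 h) // ?(H1 h) // hf //; case: pselect => // /esym //.
Qed.

Lemma simple_contraction_expansion A (Y Z : set A) : model A ->
  basis Y -> simple_contraction Y Z -> simple_expansion Z Y.
Proof.
move=> MA [freeY _] [i [a [aI aY ->]]]; exists i, (lam a); split; first by right.
(* The contracted element is not already among the others: otherwise a homomorphism could send all
   the [a j] to [b0] and [lam a] to some [d] other than the contraction of copies of [b0]. *)
have aN : ~ (Y `\` range a) (lam a).
  move=> [Yl la].
  pose c := @lam K B i (fun=> b0).
  have [d dc] : exists d, d <> c.
    by have [b0c|] := pselect (b0 = c); [exists b1; rewrite -b0c => /esym|exists b0].
  have [h [hH hf]] :=
    freeY B modelB (fun v => if pselect (v = lam a) then d else b0).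
  apply: dc; transitivity (h (lam a)); first by rewrite hf //; case: pselect.
  rewrite hH.1 /c; congr lam; apply/funext => j.
  rewrite hf; last by apply: aY; exists j.
  by case: pselect => // E; case: la; exists j.
have -> : range (fun j : 'I_(arity i) => alp j (lam a)) = range a.
  by congr image; apply/funext => j; apply: lamK.
apply/seteqP; split=> u.
  have [ua|ua] := pselect (range a u); first by right.
  by move=> Yu; left; split; [left|move=> E; apply: aN; rewrite -E].
by case=> [[[[]//|E]]|/aY].
Qed.

End Nontrivial.

(** * The algebra [cantor S2 r] as the free model on [r] generators *)

Section Cantor.
Variable r : nat.
Local Notation U := (cantor S2 r).

Definition var (x : 'I_r) : U := cantor_pi S2 (Var x).

Definition gens : set U := range var.

Lemma eval_cantor (X : Type) (rho : X -> U) w :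
  eval rho w = cantor_pi S2 (subst (fun x => repr (rho x)) w).
Proof.
elim: w => [x|i f IH|i j v IH].
- by rewrite /= /cantor_pi reprK.
- transitivity (@lam K U i (fun j => eval rho (f j))) => //.
  by rewrite [RHS]cantor_pi_lam; congr (@lam K U i _); apply/funext.
- transitivity (@alp K U i j (eval rho v)) => //.
  by rewrite [RHS]cantor_pi_alp IH.
Qed.

Lemma cantor_model : model U.
Proof.
by move=> l l' H rho; rewrite !eval_cantor; apply/cantor_piE/cong_law.
Qed.

Lemma cantor_pi_surj (u : U) : cantor_pi S2 (repr u) = u.
Proof. exact: reprK. Qed.

Lemma cantor_ind (P : U -> Prop) : (forall w, P (cantor_pi S2 w)) -> forall u, P u.
Proof. by move=> H u; rewrite -(cantor_pi_surj u). Qed.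

(** The map evaluates a representative; [eval_cong] makes the result independent of the choice. *)
Lemma cantor_extend A (f : 'I_r -> A) : model A ->
  exists h : U -> A, is_hom h /\ forall x, h (var x) = f x.
Proof.
move=> MA; pose h (u : U) := eval f (repr (u : cantor_type S2 r)).
have hE w : h (cantor_pi S2 w) = eval f w.
  by apply: eval_cong => //; apply/cantor_piE; apply: cantor_pi_surj.
exists h; split; last by move=> x; rewrite hE.
split=> [i a|i j u] /=; first by rewrite hE.
by rewrite hE.
Qed.

Lemma gens_basis : basis gens.
Proof.
split=> [B MB f|].
  have [h [hH hf]] := cantor_extend (fun x => f (var x)) MB.
  by exists h; split=> // _ [x _ <-].
apply: cantor_ind; elim=> [x|i f IH|i j v IH].
- by apply: gen_in; exists x.
- by rewrite cantor_pi_lam; apply: gen_lam.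
- by rewrite cantor_pi_alp; apply: gen_alp.
Qed.

Lemma gens_finite : finite_set gens.
Proof. exact/finite_image/finite_finset. Qed.

End Cantor.

(** Validity enters here: if the two generators became equal, the admissible set of two variables
    would have a singleton as image. *)
Lemma valid_nontrivial : valid S2 2 ->
  exists b0 b1 : cantor S2 2, b0 <> b1.
Proof.
move=> v2; pose x0 : 'I_2 := ord0; pose x1 : 'I_2 := ord_max.
exists (cantor_pi S2 (Var x0)), (cantor_pi S2 (Var x1)) => E.
have := v2 _ (adm_base _); rewrite /W_admissible.
rewrite (_ : @cantor_pi K S2 2 @` _ = [set cantor_pi S2 (Var x0)]); last first.
  apply/seteqP; split=> u; last by move=> ->; exists (Var x0) => //; exists x0.
  case=> _ [x _ <-] <-; have [->//|->//] : x = x0 \/ x = x1.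
  by case: x => [[|[|//]]] H; [left|right]; apply: val_inj.
move=> H; have /eq_cardSP [y _] := card_eq_trans H card_set1.
rewrite II0 card_eq0 => /eqP Y0.
have V0 : y = Var x0 by apply: contrapT => yx; suff: set0 (Var x0 : term K 'I_2)
  by []; rewrite -Y0; split; [exists x0|move=> /esym].
suff: set0 (Var x1 : term K 'I_2) by [].
by rewrite -Y0 V0; split; [exists x1|].
Qed.

End Model.

(** * Upper bounds of admissible sets *)

Section AutImage.
Variables (K : colours) (A : Oalg K).
Implicit Types (g h : aut A) (V W : set A).

Lemma aut_inj g : injective g. Proof. exact: can_inj (@aut_funK _ _ g). Qed.

Lemma aut_mulE g h u : (g * h) u = h (g u). Proof. by []. Qed.

Lemma aut_VK g u : g^-1 (g u) = u. Proof. exact: aut_funK. Qed.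

Lemma aut_KV g u : g (g^-1 u) = u. Proof. exact: aut_invK. Qed.

Lemma image_autM g h V : (g * h) @` V = h @` (g @` V).
Proof. by rewrite image_comp. Qed.

Lemma image_autVK g V : (g^-1)%g @` (g @` V) = V.
Proof. by rewrite -image_autM mulgV image_id. Qed.

Lemma image_autKV g V : g @` ((g^-1)%g @` V) = V.
Proof. by rewrite -image_autM mulVg image_id. Qed.

Lemma aut_expands g V W : expands V W -> expands (g @` V) (g @` W).
Proof. by apply: image_expands (hom_aut g) _ => u v _ _ /aut_inj. Qed.

End AutImage.

Lemma subgroup1 (gT : groupType) (S : set gT) : subgroup S -> S 1.
Proof. by case=> /set_mem. Qed.

Lemma subgroupV (gT : groupType) (S : set gT) x : subgroup S -> S x -> S x^-1.
Proof.
by move=> SS Sx; apply: set_mem; apply: group_closedV SS _ _; apply: mem_set.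
Qed.

Lemma subgroupM (gT : groupType) (S : set gT) x y :
  subgroup S -> S x -> S y -> S (x * y).
Proof.
move=> SS Sx Sy; apply: set_mem; apply: (group_closedM SS) => //;
  exact: mem_set.
Qed.

Lemma subgroupI (gT : groupType) (S : set gT) : S 1 ->
  (forall x y, S x -> S y -> S (x * y)) -> (forall x, S x -> S x^-1) ->
  subgroup S.
Proof.
move=> S1 SM SV; split; first exact: mem_set.
by move=> x y /set_mem Sx /set_mem Sy; apply: mem_set; apply: SM => //; apply: SV.
Qed.

Section Bounded.
Variables (K : colours) (S2 : laws2 K).
Hypothesis hvalid : forall m, (0 < m)%N -> valid S2 m.
Hypothesis hbounded : forall m, (0 < m)%N -> bounded S2 m.

Lemma U_basis r (Y : set (cantor S2 r)) : U_admissible Y -> basis S2 Y.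
Proof. exact: (admissible_basis (@cantor_model K S2 r) (@gens_basis K S2 r)). Qed.

Lemma U_separated r (Y : set (cantor S2 r)) : U_admissible Y -> separated Y.
Proof.
have [b0 [b1 b01]] := valid_nontrivial (hvalid (isT : 0 < 2)%N).
by move=> /U_basis; apply: (basis_separated (@cantor_model K S2 2) b01).
Qed.

Lemma U_finite r (Y : set (cantor S2 r)) : U_admissible Y -> finite_set Y.
Proof. exact: admissible_finite (@gens_finite _ _ r). Qed.

Lemma U_contraction r (Y Z : set (cantor S2 r)) : U_admissible Y ->
  simple_contraction Y Z -> simple_expansion Z Y.
Proof.
have [b0 [b1 b01]] := valid_nontrivial (hvalid (isT : 0 < 2)%N).
move=> /U_basis; apply: (simple_contraction_expansion (@cantor_model K S2 2) b01).
exact: cantor_model.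
Qed.

Lemma U_expands r (Y Z : set (cantor S2 r)) :
  U_admissible Y -> expands Y Z -> U_admissible Z.
Proof. exact: admissible_expands. Qed.

Lemma lub_exists r (A B C : set (cantor S2 r)) : (0 < r)%N ->
  U_admissible A -> expands A B -> expands A C -> exists T, is_lub B C T.
Proof.
move=> r0 aA AB AC.
have [|T [? _]] := hbounded r0 (U_expands aA AB) (U_expands aA AC).
  by exists A.
by exists T.
Qed.

(** Induction along the admissible chain: an expansion step takes the least upper bound of [T] and
    [Z] above [Y], and a contraction step is an expansion read backwards. *)
Lemma common_expansion_gens r (Y : set (cantor S2 r)) : (0 < r)%N ->
  U_admissible Y -> exists2 T, expands (@gens K S2 r) T & expands Y T.
Proof.
move=> r0; elim=> {Y} [|Y Z aY [T XT YT] YZ|Y Z aY [T XT YT] YZ].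
- by exists (@gens K S2 r); apply: expands_refl.
- have EYZ := expands_step (expands_refl Y) YZ.
  have [L [_ TL ZL _]] := lub_exists r0 aY YT EYZ.
  by exists L => //; apply: expands_trans TL.
- exists T => //; apply: expands_trans YT.
  exact: expands_step (expands_refl Z) (U_contraction aY YZ).
Qed.

Lemma common_expansion r (B C : set (cantor S2 r)) : (0 < r)%N ->
  U_admissible B -> U_admissible C -> exists2 T, expands B T & expands C T.
Proof.
move=> r0 aB aC; have [T XT BT] := common_expansion_gens r0 aB.
have [T' XT' CT'] := common_expansion_gens r0 aC.
have [L [_ TL TL' _]] := lub_exists r0 (adm_base _) XT XT'.
by exists L; [apply: expands_trans TL|apply: expands_trans TL'].
Qed.

(** The common lower bound [Y] is what allows boundedness to be applied at each stage of the
    iteration. *)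
Lemma lub_seq r (Y : set (cantor S2 r)) (s : seq (set (cantor S2 r))) :
    (0 < r)%N -> U_admissible Y -> (forall B, B \in s -> expands Y B) ->
  exists T, [/\ expands Y T, forall B, B \in s -> expands B T &
    forall S, expands Y S -> (forall B, B \in s -> expands B S) -> expands T S].
Proof.
move=> r0 aY; elim: s => [_|B s IH sY].
  by exists Y; split=> //; apply: expands_refl.
have [|T [YT sT Tmin]] := IH.
  by move=> C Cs; apply: sY; rewrite in_cons Cs orbT.
have [|L [aL TL BL Lmin]] := lub_exists r0 aY YT (C := B).
  by apply: sY; rewrite in_cons eqxx.
exists L; split.
- exact: expands_trans TL.
- move=> C; rewrite in_cons => /orP[/eqP->//|/sT CT].
  exact: expands_trans TL.
- move=> S YS sS; apply: Lmin.
  + exact: U_expands YS.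
  + by apply: Tmin => // C Cs; apply: sS; rewrite in_cons Cs orbT.
  + by apply: sS; rewrite in_cons eqxx.
Qed.

(** Both [S] and [T] are least upper bounds of the pair [T], [T], and boundedness makes that bound
    unique. *)
Lemma expands_anti r (S T : set (cantor S2 r)) : (0 < r)%N ->
  U_admissible S -> expands S T -> expands T S -> S = T.
Proof.
move=> r0 aS ST TS; have aT := U_expands aS ST.
have [|L [_ Luniq]] := hbounded r0 aT aT.
  by exists T; split=> //; apply: expands_refl.
have LT : L = T by apply: Luniq; split=> //; apply: expands_refl.
rewrite -LT; apply/esym; apply: Luniq; split=> // R aR TR _.
exact: expands_trans TR.
Qed.

Section Fixed.
Variables (r : nat) (r0 : (0 < r)%N) (Q : set (aut (cantor S2 r))).
Hypotheses (hQ : subgroup Q) (hQfin : finite_set Q).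
Variable Y : set (cantor S2 r).
Hypotheses (aY : U_admissible Y) (fY : Q_fixed Q Y).

(** The set [V] is the least upper bound of the translates under [Q] of a common expansion [T].
    Minimality gives [V <= Vq] for every [q]; using it for [q^-1] as well, antisymmetry yields
    [V = Vq]. *)
Lemma fixed_expansion (s : seq (set (cantor S2 r))) :
  (forall B, B \in s -> expands Y B) ->
  exists V, [/\ expands Y V, Q_fixed Q V & forall B, B \in s -> expands B V].
Proof.
move=> sY; have [T [YT sT _]] := lub_seq r0 aY sY.
have /finite_seqP[sQ EQ] := hQfin.
pose tr := [seq q @` T | q : aut _ <- sQ].
have qT (q : aut _) : Q q -> q @` T \in tr.
  by move=> Qq; apply: map_f; move: Qq; rewrite EQ.
have trP B : B \in tr -> exists2 q : aut _, Q q & B = q @` T.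
  by case/mapP=> q qs ->; exists q => //; rewrite EQ.
have [|V [YV trV Vmin]] := lub_seq r0 aY (s := tr).
  by move=> _ /trP[q Qq ->]; rewrite -(fY Qq); apply: aut_expands.
have VqV (q : aut _) : Q q -> expands V (q @` V).
  move=> Qq; apply: Vmin; first by rewrite -(fY Qq); apply: aut_expands.
  move=> _ /trP[q' Qq' ->].
  have -> : q' @` T = q @` ((q' * q^-1)%g @` T).
    by rewrite -image_autM -mulgA mulVg mulg1.
  apply: aut_expands.
  exact/trV/qT/(subgroupM hQ)/(subgroupV hQ).
exists V; split=> // [q Qq|B Bs]; last first.
  apply: expands_trans (sT _ Bs) _; rewrite -[T](@image_id _ T).
  by have := trV _ (qT _ (subgroup1 hQ)).
apply: (expands_anti r0).
- by apply: U_expands aY _; apply: expands_trans YV (VqV q Qq).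
- rewrite -[X in expands _ X](image_autKV q); apply: aut_expands.
  exact/VqV/(subgroupV hQ).
- exact: VqV.
Qed.

End Fixed.

Section CantorGroup.
Variables (r : nat) (r0 : (0 < r)%N).
Local Notation U := (cantor S2 r).
Local Notation G := (@cantor_group K S2 r).

Lemma cantor_groupI (g : aut U) (V : set U) :
  U_admissible V -> U_admissible (g @` V) -> G g.
Proof.
move=> aV aW; exists V, (g @` V).
have bij : set_bij V (g @` V) g.
  split; [by move=> u Vu; exists u|by move=> u v _ _ /aut_inj|by []].
by split=> //; apply/card_esym/inj_card_eq => u v _ _ /aut_inj.
Qed.

Lemma cantor_groupP (g : aut U) : G g ->
  exists V, U_admissible V /\ U_admissible (g @` V).
Proof.
move=> [V [W [aV aW _ [gVW _ gs]]]]; exists V; split=> //.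
rewrite (_ : g @` V = W) //; apply/seteqP; split=> //.
by move=> _ [u Vu <-]; apply: gVW.
Qed.

(** A common expansion [T] of [gV] and [Y] is pulled back by [g] and expanded again to lie above
    [Y]; its image still lies above [T]. *)
Lemma cantor_group_expands (g : aut U) (Y : set U) : U_admissible Y -> G g ->
  exists V, expands Y V /\ expands Y (g @` V).
Proof.
move=> aY /cantor_groupP[V [aV agV]].
have [T gVT YT] := common_expansion r0 agV aY.
have aT : U_admissible ((g^-1)%g @` T).
  apply: (U_expands aV); rewrite -(image_autVK g V); exact: aut_expands.
have [T' TT' YT'] := common_expansion r0 aT aY.
exists T'; split=> //; apply: expands_trans YT _.
by rewrite -[T](image_autKV g); apply: aut_expands.
Qed.

Lemma cantor_group_subgroup : subgroup G.
Proof.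
apply: subgroupI => [|g h Gg Gh|g /cantor_groupP[V [aV agV]]].
- by apply: (@cantor_groupI _ (@gens K S2 r)); [|rewrite image_id]; apply: adm_base.
- have [V [XV XgV]] := cantor_group_expands (adm_base _) Gg.
  have [W [XW XhW]] := cantor_group_expands (adm_base _) Gh.
  have aX : U_admissible (@gens K S2 r) by apply: adm_base.
  (* The image under [g] and the domain of [h] are matched on a common expansion [T], which is
     pulled back along [g] and pushed forward along [h]. *)
  have [T gVT WT] := common_expansion r0 (U_expands aX XgV) (U_expands aX XW).
  apply: (@cantor_groupI _ ((g^-1)%g @` T)).
    apply: (U_expands (U_expands aX XV)).
    by rewrite -(image_autVK g V); apply: aut_expands.
  rewrite image_autM image_autKV; apply: (U_expands (U_expands aX XhW)).
  exact: aut_expands.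
- by apply: (@cantor_groupI _ (g @` V)) => //; rewrite image_autVK.
Qed.

End CantorGroup.

End Bounded.

(** * Orbit types *)

Lemma expands_restrict_descs (K : colours) (A : Oalg K) (Y V S : set A) :
  finite_set Y -> separated Y -> expands Y V -> S `<=` Y ->
  expands S (V `&` descs S).
Proof.
move=> finY sepY YV SY.
rewrite (_ : _ `&` _ = \bigcup_(y in S) (V `&` desc y)).
  apply: expands_bigcup => [|y y' u /SY Yy /SY Yy'|y /SY Yy].
  - exact: sub_finite_set finY.
  - exact: sepY.
  - exact: (expands_restrict sepY YV Yy).
apply/seteqP; split=> u; first by case=> Vu [y Sy yu]; exists y.
by case=> y Sy [Vu yu]; split=> //; exists y.
Qed.

Lemma expands_half (K : colours) (A : Oalg K) (Y V S : set A) :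
  finite_set Y -> separated Y -> expands Y V -> S `<=` Y ->
  expands Y ((V `&` descs S) `|` (Y `\` S)).
Proof.
move=> finY sepY YV SY; rewrite -{1}(setDUK SY); apply: expands_setUr.
  move=> u [[y Sy yu] [y' [Yy' Sy'] y'u]]; apply: Sy'.
  by rewrite (sepY _ _ _ Yy' (SY _ Sy) y'u yu).
exact: expands_restrict_descs YV SY.
Qed.

Lemma ex_aut (K : colours) (A : Oalg K) (f g : A -> A) :
  is_hom f -> cancel f g -> cancel g f -> exists a : aut A, forall u, a u = f u.
Proof. by move=> [fl fa] fK gK; exists (Aut fK gK fl fa). Qed.

Section SubGroup.
Variables (gT : groupType) (S : set gT) (hS : subgroup S).

Record sub_group := SubElt { sub_val :> gT; sub_valP : S sub_val }.

Lemma sub_val_inj : injective sub_val.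
Proof.
by case=> x Sx [y Sy] /= E; subst y; congr SubElt; apply: Prop_irrelevance.
Qed.

(* Records hS in the type, so that the group structure can be inferred. *)
Definition sub_group_of (_ : subgroup S) : Type := sub_group.
Local Notation sG := (sub_group_of hS).

HB.instance Definition _ := gen_eqMixin sG.
HB.instance Definition _ := gen_choiceMixin sG.

Let one : sG := SubElt (subgroup1 hS).
Let mul (x y : sG) : sG := SubElt (subgroupM hS (sub_valP x) (sub_valP y)).
Let inv (x : sG) : sG := SubElt (subgroupV hS (sub_valP x)).

Fact sub_mulA : associative mul.
Proof. by move=> x y z; apply: sub_val_inj; apply: mulgA. Qed.
Fact sub_mul1 : left_id one mul.
Proof. by move=> x; apply: sub_val_inj; apply: mul1g. Qed.
Fact sub_mulr1 : right_id one mul.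
Proof. by move=> x; apply: sub_val_inj; apply: mulg1. Qed.
Fact sub_mulV : left_inverse one inv mul.
Proof. by move=> x; apply: sub_val_inj; apply: mulVg. Qed.
Fact sub_mulrV : right_inverse one inv mul.
Proof. by move=> x; apply: sub_val_inj; apply: mulgV. Qed.

HB.instance Definition _ :=
  isGroup.Build sG sub_mulA sub_mul1 sub_mulr1 sub_mulV sub_mulrV.

Lemma sub_valM (x y : sG) : sub_val (x * y) = sub_val x * sub_val y.
Proof. by []. Qed.

End SubGroup.

(** * Transitive [Q]-sets and their stabilisers *)

Section QSetLemmas.
Variables (gT : groupType) (Q : set gT) (hQ : subgroup Q).

(** The map sends [x q] to [z q]; equality of stabilisers makes it both well defined and injective.
    The target is a bare action, so that [U] itself may serve as [Z]. *)
Lemma equivariant_map (S : qset Q) (x : S) (Z : Type) (act : Z -> gT -> Z) z :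
  transitive_qset S -> (forall w, act w 1 = w) ->
  (forall w q q', Q q -> Q q' -> act w (q * q') = act (act w q) q') ->
  (forall q, Q q -> (qact x q = x <-> act z q = z)) ->
  exists b : S -> Z, [/\ b x = z, injective b &
    forall s q, Q q -> b (qact s q) = act (b s) q].
Proof.
move=> [_ trS] act1 actM stab.
(* Two elements of [Q] agree at a point exactly when [q * q'^-1] fixes it, so coincidences transfer
   between [x] and [z]. *)
have key q q' : Q q -> Q q' -> (qact x q = qact x q' <-> act z q = act z q').
  move=> Qq Qq'; have Qv := subgroupV hQ Qq'.
  have sxz := stab _ (subgroupM hQ Qq Qv).
  split=> E.
    have Ez : act z (q * q'^-1) = z.
      by apply/sxz; rewrite qactM // E -qactM // mulgV qact1.
    by rewrite -[in RHS]Ez -actM -?mulgA ?mulVg ?mulg1 //; apply: (subgroupM hQ).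
  have Ex : qact x (q * q'^-1) = x.
    by apply/sxz; rewrite actM // E -actM // mulgV act1.
  by rewrite -[in RHS]Ex -qactM -?mulgA ?mulVg ?mulg1 //; apply: (subgroupM hQ).
have /choice [sel selP] : forall s, exists q, Q q /\ qact x q = s.
  by move=> s; have [q Qq E] := trS x s; exists q.
exists (fun s => act z (sel s)); split.
- by apply/stab; case: (selP x).
- move=> s s'; have [Qs <-] := selP s; have [Qs' <-] := selP s'.
  have [Q2 E2] := selP (qact x (sel s)); have [Q2' E2'] := selP (qact x (sel s')).
  by move/(key _ _ Q2 Q2'); rewrite E2 E2'.
- move=> s q Qq; have [Qs Es] := selP s; have [Q2 E2] := selP (qact s q).
  rewrite -actM //; apply/key => //; first exact: subgroupM.
  by rewrite E2 qactM // Es.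
Qed.

Lemma qset_iso_stab (S S' : qset Q) (x : S) (x' : S') :
  transitive_qset S -> transitive_qset S' ->
  (forall q, Q q -> (qact x q = x <-> qact x' q = x')) -> qset_iso S S'.
Proof.
move=> tS tS' stab.
have [b [bx bI bE]] := equivariant_map tS (@qact1 _ _ S') (@qactM _ _ S') stab.
exists b => //.
have bS z : exists s, b s = z.
  by have [q Qq <-] := tS'.2 x' z; exists (qact x q); rewrite bE // bx.
have /choice [c cK] := bS.
by exists c => // s; apply: bI; rewrite cK.
Qed.

End QSetLemmas.

Lemma sval_inj (X : Type) (P : X -> Prop) : injective (@sval X P).
Proof.
case=> x Px [y Py] /= E; subst y; congr exist; exact: Prop_irrelevance.
Qed.

Section Types.
Variables (K : colours) (S2 : laws2 K) (r : nat).
Local Notation U := (cantor S2 r).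
Variables (Q : set (aut U)) (hQ : subgroup Q).

Definition same_stab (T : qset Q) (x : T) (y : U) : Prop :=
  forall q : aut U, Q q -> (qact x q = x <-> q y = y).

(** Turns an isomorphism of orbits into a condition on stabilisers; the converse map comes from
    [equivariant_map]. *)
Lemma has_typeP (T : qset Q) (y : U) : transitive_qset T ->
  has_type (orbit_of Q y) T <-> exists x : T, same_stab x y.
Proof.
move=> tT; split=> [[b [[_ bI bS] bE]]|[x xy]].
  have [x _ bx] : exists2 x, setT x & b x = y.
    by apply: bS; exists 1; [exact: subgroup1|].
  exists x => q Qq; rewrite -bx -bE //; split=> [->//|].
  by apply: bI; rewrite inE.
have [||b [bx bI bE]] :=
  equivariant_map hQ (Z := U) (act := fun u (q : aut U) => q u) tT _ _ xy => //.
exists b; split=> //; split=> [s _|s s' _ _ /bI//|_ [q Qq <-]].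
  by have [q Qq <-] := tT.2 x s; exists q => //; rewrite bE // bx.
by exists (qact x q) => //; rewrite bE // bx.
Qed.

(** A [qset] takes every element of the ambient group as argument; outside [Q] the identity serves
    as a dummy action. *)
Definition orbit_act (y : U) (u : {u | orbit_of Q y u}) (q : aut U) :
  {u | orbit_of Q y u}.
Proof.
case: (pselect (Q q)) => [Qq|_]; last exact: u.
exists (q (sval u)); case: (svalP u) => q' Qq' <-.
by exists (q' * q) => //; apply: subgroupM.
Defined.

Lemma orbit_actE y u q : Q q -> sval (@orbit_act y u q) = q (sval u).
Proof. by move=> Qq; rewrite /orbit_act; case: pselect. Qed.

Lemma orbit_act1 y u : @orbit_act y u 1 = u.
Proof. by apply: sval_inj => /=; rewrite orbit_actE //; apply: subgroup1. Qed.

Lemma orbit_actM y u q q' : Q q -> Q q' ->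
  @orbit_act y u (q * q') = orbit_act (orbit_act u q) q'.
Proof.
by move=> Qq Qq'; apply: sval_inj; rewrite /= !orbit_actE //; apply: subgroupM.
Qed.

Definition orbit_qset (y : U) : qset Q := QSet (@orbit_act1 y) (@orbit_actM y).

Lemma orbit_qset_transitive (y : U) : transitive_qset (orbit_qset y).
Proof.
split; first by exists (exist _ y (ex_intro2 _ _ _ (subgroup1 hQ) erefl)).
move=> [u [q Qq qy]] [u' [q' Qq' q'y]].
have QVq : Q (q^-1 * q') by apply: subgroupM => //; apply: subgroupV.
exists (q^-1 * q') => //; apply: sval_inj.
by rewrite /= orbit_actE //= -qy aut_funK.
Qed.

Lemma orbit_of_aut (q : aut U) y : Q q -> orbit_of Q (q y) = orbit_of Q y.
Proof.
move=> Qq; apply/seteqP; split=> _ [q' Qq' <-].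
  by exists (q * q') => //; apply: subgroupM.
exists (q^-1 * q'); first by apply: subgroupM => //; apply: subgroupV.
by rewrite /= aut_funK.
Qed.

Variables (t : nat) (T : 'I_t -> qset Q) (hT : transitive_types T).

Definition typ (j : 'I_t) (y : U) : Prop := has_type (orbit_of Q y) (T j).

Lemma typP j y : typ j y <-> exists x : T j, same_stab x y.
Proof. by apply: has_typeP; case: hT. Qed.

Lemma typ_total y : exists j, typ j y.
Proof.
have [trT _ /(_ _ (orbit_qset_transitive y)) [j [b bB bE]]] := hT.
pose o : orbit_qset y := exist _ y (ex_intro2 _ _ _ (subgroup1 hQ) erefl).
exists j; apply/typP; exists (b o) => q Qq; rewrite -bE //; split=> [/(bij_inj bB)|E].
  by move=> /(congr1 sval); rewrite /= orbit_actE.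
by congr b; apply: sval_inj; rewrite /= orbit_actE.
Qed.

Lemma typ_uniq j k y : typ j y -> typ k y -> j = k.
Proof.
have [trT uT _] := hT; move=> /typP[x xy] /typP[x' x'y]; apply: uT.
by apply: (qset_iso_stab hQ (x := x) (x' := x')) => // q Qq; rewrite xy // x'y.
Qed.

Lemma typ_aut j (q : aut U) y : Q q -> typ j (q y) <-> typ j y.
Proof. by move=> Qq; rewrite /typ orbit_of_aut. Qed.

Lemma typ_stab j y y' : (forall q : aut U, Q q -> (q y = y <-> q y' = y')) ->
  typ j y -> typ j y'.
Proof.
by move=> E /typP[x xy]; apply/typP; exists x => q Qq; rewrite xy // E.
Qed.

Section Pi.
Variables (Y : set U) (fY : Q_fixed Q Y).

Lemma Q_fixed_mem (q : aut U) y : Q q -> Y y -> Y (q y).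
Proof. by move=> Qq Yy; rewrite -(fY Qq); exists y. Qed.

Lemma orbit_representatives (j : 'I_t) (m : nat) :
    orbits_of_type Y (T j) #= `I_m ->
  exists s : 'I_m -> U, [/\ forall k, Y (s k) /\ typ j (s k),
    forall k l (q : aut U), Q q -> (q (s k) = s k <-> q (s l) = s l),
    forall y, Y y -> typ j y -> exists k (q : aut U), Q q /\ y = q (s k) &
    forall k l (q : aut U), Q q -> q (s k) = s l -> k = l].
Proof.
move=> E.
have /card_set_bijP [O [Ofun Oinj Osurj]] :=
  card_eq_trans (card_esym (@card_II m)) (card_esym E).
(* A single point [x0] of [T j] marks the representative in every orbit of type [j], so that all
   representatives share the stabiliser of [x0]. *)
have [[x0 _] _] : transitive_qset (T j) by case: hT.
have /choice [s sP] : forall k, exists y,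
    [/\ Y y, O k = orbit_of Q y & same_stab x0 y].
  move=> k; have [[y Yy Ok] [b [[bfun bI _] bE]]] := Ofun k I.
  have [q Qq qy] : orbit_of Q y (b x0) by rewrite -Ok; apply: bfun.
  exists (b x0); split.
  - by rewrite -qy; apply: Q_fixed_mem.
  - by rewrite -qy orbit_of_aut.
  - by move=> q' Qq'; rewrite -bE //; split=> [->//|]; apply: bI; rewrite inE.
exists s; split.
- by move=> k; have [Ys _ st] := sP k; split=> //; apply/typP; exists x0.
- move=> k l q Qq; have [_ _ sk] := sP k; have [_ _ sl] := sP l.
  by rewrite -sk // sl.
- move=> y Yy ty; have [k _ Ok] : exists2 k, setT k & O k = orbit_of Q y.
    by apply: Osurj; split=> //; exists y.
  have [_ Osk _] := sP k; have : orbit_of Q (s k) y.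
    by rewrite -Osk Ok; exists 1; [apply: subgroup1|].
  by case=> q Qq <-; exists k, q.
- move=> k l q Qq E'; apply: Oinj; rewrite ?inE //.
  have [_ -> _] := sP k; have [_ -> _] := sP l.
  by rewrite -E' orbit_of_aut.
Qed.

End Pi.

End Types.

(** * The direct decomposition of the centraliser *)

Section Centraliser.
Variables (K : colours) (S2 : laws2 K).
Hypothesis hvalid : forall m, (0 < m)%N -> valid S2 m.
Hypothesis hbounded : forall m, (0 < m)%N -> bounded S2 m.
Variables (r : nat) (r0 : (0 < r)%N).
Local Notation U := (cantor S2 r).
Local Notation G := (@cantor_group K S2 r).
Variables (Q : set (aut U)) (hQ : subgroup Q) (hQfin : finite_set Q).
Variables (Y : set U) (aY : U_admissible Y) (fY : Q_fixed Q Y).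
Variables (t : nat) (T : 'I_t -> qset Q) (hT : transitive_types T).
Local Notation C := (centraliser G Q).

Lemma hom_ext (B : Oalg K) (f g : U -> B) : is_hom f -> is_hom g ->
  (forall y, Y y -> f y = g y) -> f = g :> (U -> B).
Proof.
move=> fH gH fg; apply/funext => u; apply: (hom_eq_gen fH gH fg).
by case: (U_basis aY).
Qed.

Lemma hom_exists (f : U -> U) :
  exists h : U -> U, is_hom h /\ forall y, Y y -> h y = f y.
Proof. by have [free _] := U_basis aY; apply/free/cantor_model. Qed.

Lemma desc_uniq y y' u : Y y -> Y y' -> desc y u -> desc y' u -> y = y'.
Proof. exact: (U_separated hvalid aY). Qed.

Lemma commE (g q : aut U) u : commute g q -> q (g u) = g (q u).
Proof. by move=> /(congr1 (fun h : aut U => h u)). Qed.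

Lemma centraliser_comm (g q : aut U) u : C g -> Q q -> q (g u) = g (q u).
Proof. by move=> [_ Cg] /Cg/commE. Qed.

Lemma centraliserI (g : aut U) : G g ->
  (forall (q : aut U) y, Q q -> Y y -> q (g y) = g (q y)) -> C g.
Proof.
move=> Gg H; split=> // q Qq; apply: aut_eq => u.
have E := hom_ext (hom_aut (g * q)) (hom_aut (q * g)) (fun y => H q y Qq).
exact: (congr1 (@^~ u) E).
Qed.

Lemma centraliser_subgroup : subgroup C.
Proof.
have SG := cantor_group_subgroup hvalid hbounded r0.
apply: subgroupI => [|g h [Gg Cg] [Gh Ch]|g [Gg Cg]].
- by split=> [|q _]; [apply: subgroup1|apply: commute_sym; apply: commute1].
- split=> [|q Qq]; first exact: subgroupM.
  by apply/commute_sym/commuteM; apply/commute_sym; [apply: Cg|apply: Ch].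
- split=> [|q Qq]; first exact: subgroupV.
  by apply/commute_sym/commuteV/commute_sym/Cg.
Qed.

Lemma centraliser_expands (g : aut U) : C g ->
  exists V, [/\ expands Y V, Q_fixed Q V & expands Y (g @` V)].
Proof.
move=> Cg; have [V [YV YgV]] := cantor_group_expands hvalid hbounded r0 aY Cg.1.
have [|W [YW fW VW]] :=
  fixed_expansion hbounded r0 hQ hQfin aY fY (s := [:: V]).
  by move=> B; rewrite inE => /eqP ->.
exists W; split=> //; apply: expands_trans YgV (aut_expands _ (VW _ _)).
by rewrite inE.
Qed.

(** If [q] fixes [v], then [y] and [q y] are elements of [Y] with the common descendant [v], hence
    equal by separation. *)
Lemma desc_stab y v (q : aut U) : Y y -> desc y v -> Q q ->
  (q v = v <-> q y = y).
Proof.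
move=> Yy yv Qq; split=> E; last first.
  exact: (hom_eq_desc (hom_aut q) (@hom_id _ U) E yv).
apply: (@desc_uniq _ _ v) => //; first exact: (Q_fixed_mem fY).
by rewrite -E; apply: hom_desc yv; apply: hom_aut.
Qed.

(** Since [g] commutes with [Q], [v] and [g v] have equal stabilisers, and [desc_stab] carries this
    to [y] and [y']. *)
Lemma centraliser_typ (g : aut U) j y y' v : C g -> Y y -> Y y' ->
  desc y v -> desc y' (g v) -> typ T j y -> typ T j y'.
Proof.
move=> Cg Yy Yy' yv yv'; apply: (typ_stab hQ hT) => q Qq.
rewrite -(desc_stab Yy yv Qq) -(desc_stab Yy' yv' Qq) centraliser_comm //.
by split=> [->//|/aut_inj].
Qed.

Definition part (j : 'I_t) : set U := [set y | Y y /\ typ T j y].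

Lemma part_sub j : part j `<=` Y. Proof. by move=> y []. Qed.

Lemma part_aut j (q : aut U) y : Q q -> part j y -> part j (q y).
Proof.
by move=> Qq [Yy ty]; split; [apply: (Q_fixed_mem fY)|apply/(typ_aut hQ)].
Qed.

Lemma part_autI j (q : aut U) y : Q q -> part j (q y) -> part j y.
Proof.
move=> Qq /(part_aut (subgroupV hQ Qq)); by rewrite aut_VK.
Qed.

Lemma part_descs (g : aut U) j V v : C g -> expands Y (g @` V) ->
  V v -> descs (part j) v -> descs (part j) (g v).
Proof.
move=> Cg YgV Vv [y [Yy ty] yv].
have [|y' Yy' y'v] := expands_desc YgV (z := g v); first by exists v.
by exists y' => //; split=> //; apply: (centraliser_typ Cg Yy Yy' yv).
Qed.

Lemma part_descsV (g : aut U) j V v : C g -> expands Y V ->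
  V v -> descs (part j) (g v) -> descs (part j) v.
Proof.
move=> Cg YV Vv jgv; rewrite -[v](aut_VK g).
apply: (@part_descs _ _ (g @` V)) jgv; last by exists v.
  exact: subgroupV centraliser_subgroup Cg.
by rewrite image_autVK.
Qed.

(** [y] is generated by the elements of [V] below it, and [part_descs] sends each of those below
    [part j]. *)
Lemma part_gen (g : aut U) j y : C g -> part j y -> gen (part j) (g y).
Proof.
move=> Cg jy; have [V [YV fV YgV]] := centraliser_expands Cg.
have yV := expands_restrict (U_separated hvalid aY) YV jy.1.
apply: (hom_gen (hom_aut g) _ (gen_expands (@cantor_model _ _ _) yV erefl)).
move=> v [Vv yv]; have [|y' jy' y'v] := part_descs (j := j) Cg YgV Vv.
  by exists y.
exact: desc_gen jy' y'v.
Qed.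

Lemma part_expands j V : expands Y V ->
  expands Y ((Y `\` part j) `|` (V `&` descs (part j))).
Proof.
move=> YV; rewrite setUC; apply: expands_half (U_finite aY) _ YV (@part_sub j).
exact: (U_separated hvalid aY).
Qed.

Lemma component_exists (g : aut U) j : C g -> exists h : aut U,
  [/\ C h, forall y, part j y -> h y = g y &
      forall y, Y y -> ~ part j y -> h y = y].
Proof.
move=> Cg; have CgV := subgroupV centraliser_subgroup Cg.
have homE (x : aut U) : exists h : U -> U, [/\ is_hom h,
    forall y, part j y -> h y = x y & forall y, Y y -> ~ part j y -> h y = y].
  have [h [hH hE]] := hom_exists (fun u => if pselect (part j u) then x u else u).
  exists h; split=> // y Yy; last by rewrite hE //; case: pselect.
  by rewrite hE; [case: pselect|case: Yy].
have [f [fH fj fN]] := homE g; have [f' [f'H f'j f'N]] := homE g^-1.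
have cancelI (x : aut U) h h' : C x -> is_hom h -> is_hom h' ->
    (forall y, part j y -> h y = x y) -> (forall y, Y y -> ~ part j y -> h y = y) ->
    (forall y, part j y -> h' y = x^-1 y) ->
    (forall y, Y y -> ~ part j y -> h' y = y) -> cancel h h'.
  move=> Cx hH h'H hj hN h'j h'N u.
  suff /(congr1 (@^~ u)) : h' \o h = id by [].
  apply: hom_ext (hom_comp hH h'H) (@hom_id _ _) _ => y Yy /=.
  have [jy|jy] := pselect (part j y); last by rewrite hN // h'N.
  rewrite hj // (hom_eq_gen h'H (hom_aut x^-1) h'j (part_gen Cx jy)).
  exact: (aut_VK x).
have [h hE] : exists h : aut U, forall u, h u = f u.
  apply: (ex_aut fH (g := f')); first exact: (cancelI g f f' Cg).
  by apply: (cancelI g^-1 f' f CgV) => // y jy; rewrite fj // invgK.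
have hj y : part j y -> h y = g y by move=> jy; rewrite hE fj.
have hN y : Y y -> ~ part j y -> h y = y by move=> Yy jy; rewrite hE fN.
exists h; split=> //; apply: centraliserI; last first.
  move=> q y Qq Yy; have [jy|jy] := pselect (part j y).
    rewrite (hj _ jy) (hj _ (part_aut Qq jy)); exact: centraliser_comm.
  rewrite (hN _ Yy jy) hN //; first exact: (Q_fixed_mem fY).
  by move=> /(part_autI Qq).
have [V [YV fV YgV]] := centraliser_expands Cg.
(* The expansion [V] is kept only below [part j]; on the rest of [Y] the map [h] is the identity, so
   no expansion is made there. *)
apply: (cantor_groupI (V := (Y `\` part j) `|` (V `&` descs (part j)))).
  exact: U_expands aY (part_expands j YV).
apply: U_expands aY _.
rewrite (_ : h @` _ = (Y `\` part j) `|` ((g @` V) `&` descs (part j))).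
  exact: part_expands YgV.
have hg v : descs (part j) v -> h v = g v.
  by move=> [y jy yv]; apply: hom_eq_desc (hom_aut h) (hom_aut g) (hj y jy) yv.
apply/seteqP; split=> u.
  case=> v [[Yv jv] <-|[Vv jv] <-]; first by left; rewrite hN.
  by right; rewrite hg //; split; [exists v|apply: part_descs YgV Vv jv].
case=> [[Yu ju]|[[v Vv <-] jgv]]; first by exists u; [left|rewrite hN].
suff jv : descs (part j) v by exists v; [right|rewrite hg].
exact: (part_descsV Cg YV Vv jgv).
Qed.

Definition component_group (j : 'I_t) : set (aut U) :=
  [set h | C h /\ forall y, Y y -> ~ part j y -> h y = y].

Lemma component_subgroup j : subgroup (component_group j).
Proof.
have SC := centraliser_subgroup.
apply: subgroupI => [|g h [Cg gN] [Ch hN]|g [Cg gN]].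
- by split=> //; apply: subgroup1.
- split; first exact: subgroupM.
  by move=> y Yy jy; rewrite aut_mulE gN // hN.
- split; first exact: subgroupV.
  by move=> y Yy jy; rewrite -{1}(gN _ Yy jy) aut_VK.
Qed.

Lemma part_disjoint i j y : i <> j -> part i y -> ~ part j y.
Proof. by move=> ij [_ iy] [_ jy]; apply: ij; apply: typ_uniq iy jy. Qed.

(** Factors of index other than [j] fix [part j] pointwise, hence also the subalgebra it generates,
    which contains [h j y]. *)
Lemma prod_component (h : 'I_t -> aut U) (s : seq 'I_t) j y : uniq s ->
  (forall i, component_group i (h i)) -> part j y ->
  (\prod_(i <- s) h i) y = if j \in s then h j y else y.
Proof.
move=> us hC; elim: s us y => [_|i s IH /= /andP[si us]] y jy.
  by rewrite big_nil.
rewrite big_cons aut_mulE in_cons; have [ji|ij] := eqVneq j i; last first.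
  rewrite [h i y](hC i).2 ?IH //; first exact: part_sub jy.
  by apply: part_disjoint jy; apply/eqP.
subst i => /=; rewrite (hom_eq_gen (hom_aut _) (@hom_id _ U) (S := part j)) //.
  by move=> v jv; rewrite IH // (negPf si).
by apply: part_gen => //; case: (hC j).
Qed.

Local Notation H := (fun j => sub_group_of (component_subgroup j) : groupType).

Lemma centraliser_isomorphic : isomorphic_to C (dprod_group H).
Proof.
have /choice [e eP] : forall gj : aut U * 'I_t, exists h : aut U,
    C gj.1 -> component_group gj.2 h /\ forall y, part gj.2 y -> h y = gj.1 y.
  move=> [g j]; have [Cg|Cg] := pselect (C g); last by exists 1 => /Cg.
  by have [h [Ch hj hN]] := component_exists j Cg; exists h.
(* Off the centraliser the value is an arbitrary [1]; the isomorphism is tested on [C] only. *)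
pose f (g : aut U) : dprod_group H := fun j =>
  if pselect (C g) is left Cg
  then SubElt (S := component_group j) (eP (g, j) Cg).1 : H j else 1.
have fj g j y : C g -> part j y -> sub_val (f g j) y = g y.
  by move=> Cg jy; rewrite /f; case: pselect => //= Cg'; apply: (eP (g, j) Cg).2.
have fN g j y : C g -> Y y -> ~ part j y -> sub_val (f g j) y = y.
  by move=> Cg; apply: (sub_valP (f g j)).2.
exists f; split.
  move=> g g' Cg Cg'.
  have Cgg' := subgroupM centraliser_subgroup Cg Cg'.
  apply: functional_extensionality_dep => j; apply: sub_val_inj.
  apply: aut_eq => u.
  have -> : sub_val ((f g * f g') j) = sub_val (f g j) * sub_val (f g' j) by [].
  have := @hom_ext U _ _ (hom_aut (sub_val (f (g * g') j)))
    (hom_aut (sub_val (f g j) * sub_val (f g' j))) => /(_ _)/(congr1 (@^~ u)).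
  apply=> y Yy; rewrite aut_mulE.
  have [jy|jy] := pselect (part j y); last by rewrite !fN.
  (* [g y] lies in the subalgebra generated by [part j], where the [j]-component of [g'] agrees with
     [g']. *)
  rewrite (fj _ _ _ Cgg' jy) (fj _ _ _ Cg jy) aut_mulE; apply/esym.
  apply: (hom_eq_gen (hom_aut _) (hom_aut _) _ (part_gen Cg jy)) => v jv.
  exact: fj.
split=> // [g g' /set_mem Cg /set_mem Cg' E|x _].
  apply: aut_eq => u; suff /(congr1 (@^~ u)) : g = g' :> (U -> U) by [].
  apply: hom_ext (hom_aut _) (hom_aut _) _ => y Yy.
  have [j jy] := typ_total hQ hT y.
  by rewrite -(fj g j) // -(fj g' j) // E.
(* The preimage of [x] is the product of its components: by [prod_component] it acts on each part
   through the matching factor. *)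
pose g := \prod_(i <- index_enum 'I_t) sub_val (x i).
have xC i := sub_valP (x i).
have Cg : C g.
  apply: (big_ind C); first exact: subgroup1 centraliser_subgroup.
    by move=> a b; apply: (subgroupM centraliser_subgroup).
  by move=> i _; case: (xC i).
exists g => //; apply: functional_extensionality_dep => j; apply: sub_val_inj.
apply: aut_eq => u.
suff /(congr1 (@^~ u)) : sub_val (f g j) = sub_val (x j) :> (U -> U) by [].
apply: hom_ext (hom_aut _) (hom_aut _) _ => y Yy.
have [jy|jy] := pselect (part j y); last by rewrite fN // (xC j).2.
by rewrite fj // (prod_component _ xC jy) ?index_enum_uniq // mem_index_enum.
Qed.

End Centraliser.

(** * The split extension *)

Definition multiplicative_of (gT hT : groupType) (f : gT -> hT)
    (fM : {morph f : x y / x * y}) : {multiplicative gT -> hT} :=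
  HB.pack f (isMultiplicative.Build gT hT f fM).

(** An automorphism in [L] is determined by the choice, for each [v] in [V], of an element of [Q]
    with the same effect at [v], and there are finitely many such choices. *)
Lemma finite_aut_set (K : colours) (A : Oalg K) (V : set A) (Q L : set (aut A)) :
  finite_set V -> finite_set Q -> (forall u, gen V u) ->
  (forall h, L h -> forall v, V v -> exists q : aut A, Q q /\ h v = q v) ->
  finite_set L.
Proof.
move=> finV finQ genV LV.
have /(@finite_seqP {classic A}) [sv Ev] := finV.
have /finite_seqP [sq Eq] := finQ.
pose R (phi : {ffun 'I_(size sv) -> 'I_(size sq)}) (h : aut A) :=
  forall i, h (tnth (in_tuple sv) i) = tnth (in_tuple sq) (phi i) (tnth (in_tuple sv) i).
have Rinj phi h h' : R phi h -> R phi h' -> h = h'.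
  move=> Rh Rh'; apply: aut_eq => u.
  apply: (hom_eq_gen (hom_aut h) (hom_aut h') _ (genV u)) => v.
  by rewrite Ev => /(tnthP (in_tuple sv)) [i ->]; rewrite Rh Rh'.
(* Selects the automorphism described by [phi], or [1] where there is none; the range of [Psi]
   covers [L]. *)
have /choice [Psi PsiP] : forall phi, exists h, (exists h', R phi h') -> R phi h.
  by move=> phi; have [[h Rh]|N] := pselect (exists h', R phi h');
    [exists h|exists 1 => /N].
apply: (sub_finite_set (B := range Psi)); last exact/finite_image/finite_finset.
move=> h Lh.
have /choice [phi phiP] : forall i : 'I_(size sv), exists k : 'I_(size sq),
    h (tnth (in_tuple sv) i) = tnth (in_tuple sq) k (tnth (in_tuple sv) i).
  move=> i; have [|q [Qq ->]] := LV _ Lh (tnth (in_tuple sv) i).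
    by rewrite Ev /=; apply: (mem_tnth i (in_tuple sv)).
  by move: Qq; rewrite Eq => /(tnthP (in_tuple sq)) [k ->]; exists k.
have Rh : R (finfun phi) h by move=> i; rewrite ffunE.
have RP := PsiP (finfun phi) (ex_intro _ h Rh).
by exists (finfun phi) => //; apply: (Rinj _ _ _ RP Rh).
Qed.

Lemma locally_finite_trivial (gT : groupType) :
  (forall x : gT, x = 1) -> locally_finite gT.
Proof.
by move=> g1 S _; apply: (sub_finite_set (B := [set 1])) => [x _|]; [apply: g1|].
Qed.

(** There is no term without variables, as every colour has positive arity; the algebra is therefore
    empty. *)
Lemma cantor0_group (K : colours) (S2 : laws2 K) (g : aut (cantor S2 0)) :
  g = 1 /\ @cantor_group K S2 0 g.
Proof.
have void (w : term K 'I_0) : False.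
  elim: w => [[]//|i f IH|//]; exact: IH (Ordinal (ltnW (arity_gt1 i))).
have -> : g = 1 by apply: aut_eq; apply: cantor_ind => w; case: (void w).
split=> //; apply: (@cantor_groupI _ _ _ _ (@gens K S2 0)).
  exact: adm_base.
by rewrite image_id; apply: adm_base.
Qed.

(** * The extension for a type with at least one orbit in [Y] *)

Section Extension.
Variables (K : colours) (S2 : laws2 K).
Hypothesis hvalid : forall m, (0 < m)%N -> valid S2 m.
Hypothesis hbounded : forall m, (0 < m)%N -> bounded S2 m.
Variables (r : nat) (r0 : (0 < r)%N).
Local Notation U := (cantor S2 r).
Local Notation G := (@cantor_group K S2 r).
Variables (Q : set (aut U)) (hQ : subgroup Q) (hQfin : finite_set Q).
Variables (Y : set U) (aY : U_admissible Y) (fY : Q_fixed Q Y).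
Variables (t : nat) (T : 'I_t -> qset Q) (hT : transitive_types T).
Local Notation C := (centraliser G Q).
Variables (j : 'I_t) (m : nat) (m0 : (0 < m)%N).
Local Notation Um := (cantor S2 m).
Local Notation Gm := (@cantor_group K S2 m).
Local Notation X := (@var K S2 m).
Local Notation P := (part Y T j).
Variable s : 'I_m -> U.
Hypothesis sP : forall k, P (s k).
Hypothesis s_stab : forall k l (q : aut U), Q q ->
  (q (s k) = s k <-> q (s l) = s l).
Hypothesis s_orbit : forall y, P y -> exists k (q : aut U), Q q /\ y = q (s k).
Hypothesis s_uniq : forall k l (q : aut U), Q q -> q (s k) = s l -> k = l.
Variables (iota : Um -> U) (pi : U -> Um).
Hypotheses (iotaH : is_hom iota) (piH : is_hom pi).
Hypothesis iotaE : forall k, iota (X k) = s k.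
Hypothesis piE : forall k (q : aut U), Q q -> pi (q (s k)) = X k.

Local Notation Sr := (range s).

Lemma Sr_sub : Sr `<=` Y.
Proof. by move=> _ [k _ <-]; case: (sP k). Qed.

Lemma pi_s k : pi (s k) = X k.
Proof. exact: (piE k (subgroup1 hQ)). Qed.

Lemma hom_ext_gens (B : Oalg K) (f g : Um -> B) : is_hom f -> is_hom g ->
  (forall k, f (X k) = g (X k)) -> f = g :> (Um -> B).
Proof.
move=> fH gH fg; apply: (hom_ext (adm_base _) fH gH) => _ [k _ <-]; exact: fg.
Qed.

Lemma pi_iota u : pi (iota u) = u.
Proof.
suff /(congr1 (@^~ u)) : pi \o iota = id :> (Um -> Um) by [].
apply: hom_ext_gens (hom_comp iotaH piH) (@hom_id _ _) _ => k /=.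
by rewrite iotaE pi_s.
Qed.

Lemma iota_gen u : gen Sr (iota u).
Proof.
apply: (hom_gen iotaH _ ((gens_basis S2 m).2 u)) => _ [k _ <-].
by rewrite iotaE; apply: gen_in; exists k.
Qed.

Lemma iota_pi u : gen Sr u -> iota (pi u) = u.
Proof.
apply: (hom_eq_gen (hom_comp piH iotaH) (@hom_id _ U)) => _ [k _ <-] /=.
by rewrite pi_s iotaE.
Qed.

Lemma pi_q (q : aut U) u : Q q -> gen P u -> pi (q u) = pi u.
Proof.
move=> Qq; apply: (hom_eq_gen (hom_comp (hom_aut q) piH) piH) => y Py /=.
have [k [q' [Qq' ->]]] := s_orbit Py; rewrite piE //.
by rewrite -aut_mulE piE //; apply: subgroupM.
Qed.

(** [q * q'^-1] carries one representative to another, so [k = l]; it then fixes all of them by the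
    common stabiliser. This makes constructions that choose an expression [q (s k)] well defined. *)
Lemma aut_s_eq (q q' : aut U) k l u : Q q -> Q q' -> q (s k) = q' (s l) ->
  k = l /\ q (iota u) = q' (iota u).
Proof.
move=> Qq Qq' E; have Qqq' : Q (q * q'^-1).
  by apply: subgroupM => //; apply: subgroupV.
have Ekl : (q * q'^-1) (s k) = s l by rewrite aut_mulE E aut_VK.
have kl := s_uniq Qqq' Ekl; split=> //; subst l.
have fix_s l : q (s l) = q' (s l).
  have /(congr1 q') : (q * q'^-1) (s l) = s l by apply/(s_stab _ k).
  by rewrite aut_mulE aut_KV.
apply: (hom_eq_gen (hom_aut q) (hom_aut q') _ (iota_gen u)) => _ [l _ <-].
exact: fix_s.
Qed.

Let Pgen (h : aut U) y : C h -> P y -> gen P (h y).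
Proof. exact: (part_gen hvalid hbounded r0 hQ hQfin aY fY hT). Qed.

Let Pdescs (h : aut U) V v : C h -> expands Y (h @` V) -> V v ->
  descs P v -> descs P (h v).
Proof. exact: (part_descs hvalid hQ aY fY hT). Qed.

Let PdescsV (h : aut U) V v : C h -> expands Y V -> V v ->
  descs P (h v) -> descs P v.
Proof. exact: (part_descsV hvalid hbounded r0 hQ aY fY hT). Qed.

Let SC : subgroup C.
Proof. exact: (centraliser_subgroup hvalid hbounded r0). Qed.

Let Cexpands (h : aut U) : C h ->
  exists V, [/\ expands Y V, Q_fixed Q V & expands Y (h @` V)].
Proof. exact: (centraliser_expands hvalid hbounded r0 hQ hQfin aY fY). Qed.

(** [h] commutes with [Q] and [pi] forgets translations by [Q]. This identity makes the projection
    multiplicative. *)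
Lemma pi_hom (h : aut U) u : C h -> gen P u ->
  pi (h (iota (pi u))) = pi (h u).
Proof.
move=> Ch.
have hH := hom_comp (hom_aut h) piH; have ipH := hom_comp piH iotaH.
apply: (hom_eq_gen (hom_comp ipH hH) hH) => y Py /=.
have [k [q [Qq ->]]] := s_orbit Py.
by rewrite piE // iotaE -(centraliser_comm _ Ch Qq) [RHS]pi_q //; exact: Pgen.
Qed.

Lemma projection_exists (h : aut U) : C h ->
  exists p : aut Um, forall u, p u = pi (h (iota u)).
Proof.
move=> Ch; have ChV : C h^-1.
  exact: (subgroupV SC Ch).
have can_h (g : aut U) : C g ->
    cancel (fun u => pi (g (iota u))) (fun u => pi (g^-1 (iota u))).
  move=> Cg u; have CgV : C g^-1.
    exact: (subgroupV SC Cg).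
  rewrite (pi_hom CgV) ?aut_VK ?pi_iota //.
  apply: (hom_gen (hom_aut g) _ (iota_gen u)) => _ [k _ <-].
  by apply: Pgen.
have pH := hom_comp (hom_comp iotaH (hom_aut h)) piH.
apply: (ex_aut pH (g := fun u => pi (h^-1 (iota u)))); first exact: can_h.
have hVV : (h^-1)^-1 = h by rewrite invgK.
by have := can_h _ ChV; rewrite hVV.
Qed.

Lemma descs_translate V v : Q_fixed Q V -> V v -> descs P v ->
  exists q : aut U, [/\ Q q, V (q v) & descs Sr (q v)].
Proof.
move=> fV Vv [y Py yv]; have [k [q [Qq Ey]]] := s_orbit Py; subst y.
have QV := subgroupV hQ Qq; exists q^-1; split=> //.
  exact: (Q_fixed_mem fV).
by exists (s k); [exists k|rewrite -[s k](aut_VK q); apply: hom_desc yv; apply: hom_aut].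
Qed.

Lemma descs_gen (S : set U) u : descs S u -> gen S u.
Proof. by case=> y Sy; apply: desc_gen. Qed.

(** On the descendants of [Sr] the map [pi] is injective, with inverse [iota], so expansions are
    carried along. *)
Lemma pi_expands V : expands Y V -> expands (@gens K S2 m) (pi @` (V `&` descs Sr)).
Proof.
move=> YV.
have -> : @gens K S2 m = pi @` Sr.
  apply/seteqP; split=> [_ [k _ <-]|_ [_ [k _ <-] <-]].
    by exists (s k); [exists k|rewrite pi_s].
  by exists k => //; rewrite pi_s.
apply: image_expands piH _ _.
  by move=> u v /descs_gen/iota_pi {2}<- /descs_gen/iota_pi {2}<- ->.
apply: expands_restrict_descs (U_finite aY) _ YV Sr_sub.
exact: (U_separated hvalid aY).
Qed.

(** [h] may send an element below a representative to one below a translate of a representative; an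
    element of [Q] moves it back and [pi] does not see the difference. For this both [V] and its
    image are taken [Q]-fixed. *)
Lemma projection_cantor_group (h : aut U) (p : aut Um) : C h ->
  (forall u, p u = pi (h (iota u))) -> Gm p.
Proof.
move=> Ch pE.
have [V [YV fV YhV]] := Cexpands Ch.
have fhV : Q_fixed Q (h @` V).
  move=> q Qq; apply/seteqP; split=> u.
    case=> _ [v Vv <-] <-; exists (q v); last by rewrite (centraliser_comm _ Ch Qq).
    exact: (Q_fixed_mem fV).
  case=> v Vv <-; have QV := subgroupV hQ Qq.
  exists (h (q^-1 v)); last by rewrite (centraliser_comm _ Ch Qq) aut_KV.
  by exists (q^-1 v) => //; apply: (Q_fixed_mem fV).
apply: (cantor_groupI (V := pi @` (V `&` descs Sr))).
  exact: U_expands (adm_base _) (pi_expands YV).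
rewrite (_ : p @` _ = pi @` ((h @` V) `&` descs Sr)).
  exact: U_expands (adm_base _) (pi_expands YhV).
have SrP u : descs Sr u -> descs P u.
  by case=> _ [k _ <-] ku; exists (s k).
have ppi v : descs Sr v -> p (pi v) = pi (h v).
  by move=> Sv; rewrite pE iota_pi //; apply: descs_gen.
apply/seteqP; split=> u.
  case=> _ [v [Vv Sv] <-] <-; rewrite ppi //.
  have hvP := Pdescs Ch YhV Vv (SrP _ Sv).
  have [|q [Qq hVq Sq]] := descs_translate fhV _ hvP; first by exists v.
  by exists (q (h v)) => //; rewrite pi_q //; apply: descs_gen.
case=> _ [[v Vv <-] Sv] <-.
have vP := PdescsV Ch YV Vv (SrP _ Sv).
have [q [Qq Vq Sq]] := descs_translate fV Vv vP.
exists (pi (q v)); first by exists (q v).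
rewrite ppi // -(centraliser_comm _ Ch Qq) pi_q //; apply: descs_gen.
exact: SrP.
Qed.

(** The [Q]-equivariant extension of [iota \o g], stated for plain maps because invertibility is
    obtained afterwards from a lift of [g^-1]. *)
Definition lifts (g : aut Um) (e : U -> U) : Prop :=
  [/\ is_hom e,
      forall k (q : aut U), Q q -> e (q (s k)) = q (iota (g (X k))) &
      forall y, Y y -> ~ P y -> e y = y].

Lemma lifts_uniq g e e' : lifts g e -> lifts g e' -> e = e'.
Proof.
move=> [eH es eN] [e'H e's e'N]; apply: (hom_ext aY eH e'H) => y Yy.
have [/s_orbit [k [q [Qq ->]]]|Py] := pselect (P y); last by rewrite eN ?e'N.
by rewrite es ?e's.
Qed.

Lemma lifts_exists g : exists e, lifts g e.
Proof.
have /choice [f fP] : forall y, exists u,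
    (P y -> exists k (q : aut U), [/\ Q q, y = q (s k) & u = q (iota (g (X k)))])
    /\ (~ P y -> u = y).
  move=> y; have [Py|Py] := pselect (P y); last by exists y.
  have [k [q [Qq Ey]]] := s_orbit Py.
  by exists (q (iota (g (X k)))); split=> // _; exists k, q.
have [e [eH eE]] := hom_exists aY f; exists e; split=> // [k q Qq|y Yy Py].
  have Pq : P (q (s k)) by apply: (part_aut hQ fY).
  rewrite eE; last by case: Pq.
  (* The expression chosen for [q (s k)] may be another [q' (s l)]; [aut_s_eq] shows that the value
     is the same. *)
  have [l [q' [Qq' E ->]]] := (fP (q (s k))).1 Pq.
  by have [-> ->] := aut_s_eq (g (X k)) Qq Qq' E.
by rewrite eE // (fP y).2.
Qed.

Lemma lifts_iota g e u : lifts g e -> e (iota u) = iota (g u).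
Proof.
move=> [eH es _]; suff /(congr1 (@^~ u)) : e \o iota = iota \o g :> (Um -> U) by [].
apply: hom_ext_gens (hom_comp iotaH eH) (hom_comp (hom_aut g) iotaH) _ => k /=.
by rewrite iotaE; apply: (es k 1 (subgroup1 hQ)).
Qed.

Lemma lifts_comm g e (q : aut U) u : lifts g e -> Q q -> e (q u) = q (e u).
Proof.
move=> [eH es eN] Qq.
suff /(congr1 (@^~ u)) : e \o q = q \o e :> (U -> U) by [].
apply: (hom_ext aY (hom_comp (hom_aut q) eH) (hom_comp eH (hom_aut q))) => y Yy /=.
have [/s_orbit [k [q' [Qq' ->]]]|Py] := pselect (P y).
  rewrite (es k q' Qq'); exact: (es k (q' * q) (subgroupM hQ Qq' Qq)).
rewrite (eN y) // eN //; first exact: (Q_fixed_mem fY).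
by move=> /(part_autI hQ fY Qq).
Qed.

Lemma lifts_comp g g' e e' : lifts g e -> lifts g' e' -> lifts (g * g') (e' \o e).
Proof.
move=> le le'; have [eH es eN] := le; have [e'H _ e'N] := le'.
split=> [|k q Qq|y Yy Py] /=; first exact: hom_comp.
  by rewrite es // (lifts_comm _ le' Qq) (lifts_iota _ le').
by rewrite eN // e'N.
Qed.

Lemma lifts1 : lifts 1 id.
Proof. by split=> // k q Qq; rewrite iotaE. Qed.

Lemma lift_exists g : exists e : aut U, lifts g e.
Proof.
have [e le] := lifts_exists g; have [e' le'] := lifts_exists g^-1.
have [eH _ _] := le.
(* The composite lifts [1], as does the identity, and lifts are unique. *)
have canI h h' f f' : h * h' = 1 -> lifts h f -> lifts h' f' -> cancel f f'.
  move=> E lf lf' u; have := lifts_comp lf lf'; rewrite E => l1.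
  exact: (congr1 (@^~ u) (lifts_uniq l1 lifts1)).
have [||a aE] := ex_aut eH (g := e').
- exact: canI (mulgV g) le le'.
- exact: canI (mulVg g) le' le.
by exists a; rewrite (_ : aut_fun a = e) //; apply/funext.
Qed.

(** The counterpart in [U] of an expansion of the generators of [Um]: below each [q (s k)] it
    reproduces the part of [V] below [X k]. *)
Definition spread (V : set Um) : set U :=
  (Y `\` P) `|` \bigcup_(q in Q) (q @` (iota @` V)).

Lemma spread_expands V : expands (@gens K S2 m) V -> expands Y (spread V).
Proof.
move=> XV; have sepX := U_separated hvalid (adm_base (@gens K S2 m)).
have /choice [F FP] : forall y, exists F : set U, Y y ->
    [/\ expands [set y] F, P y -> exists k (q : aut U), [/\ Q q, y = q (s k) &
      F = q @` (iota @` (V `&` desc (X k)))] & ~ P y -> F = [set y]].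
  move=> y; have [Py|Py] := pselect (P y); last first.
    by exists [set y] => Yy; split=> //; apply: expands_refl.
  have [k [q [Qq Ey]]] := s_orbit Py.
  exists (q @` (iota @` (V `&` desc (X k)))) => Yy; split=> // [|_].
    rewrite Ey -iotaE -2!image_set1; apply: aut_expands.
    apply: image_expands => // [u v _ _ E|]; first by rewrite -[u]pi_iota E pi_iota.
    by apply: (expands_restrict sepX XV); exists k.
  by exists k, q.
rewrite (_ : spread V = \bigcup_(y in Y) F y).
  apply: expands_bigcup (U_finite aY) (U_separated hvalid aY) _ => y Yy.
  by case: (FP y Yy).
apply/seteqP; split=> u.
  case=> [[Yu Pu]|[q Qq [_ [v Vv <-] <-]]].
    by exists u => //; have [_ _ ->] := FP u Yu.
  have [_ [k _ <-] kv] := expands_desc XV Vv.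
  have Pq : P (q (s k)) by apply: (part_aut hQ fY).
  have Yq : Y (q (s k)) by case: Pq.
  exists (q (s k)) => //; have [_ /(_ Pq) [l [q' [Qq' E ->]]] _] := FP _ Yq.
  have [kl ->] := aut_s_eq v Qq Qq' E; subst l.
  by exists (iota v) => //; exists v.
case=> y Yy; have [_ FY FN] := FP y Yy; have [Py|Py] := pselect (P y).
  have [k [q [Qq _ ->]]] := FY Py; case=> _ [v [Vv _] <-] <-.
  by right; exists q => //; exists (iota v) => //; exists v.
by rewrite FN // => ->; left.
Qed.

(** The lift carries the spread of [V] onto the spread of its image under [g], and both are
    admissible. *)
Lemma lift_component g (e : aut U) : lifts g e -> Gm g ->
  component_group Y T j e.
Proof.
move=> le Gg; have [_ _ eN] := le; split=> //.
apply: (centraliserI aY) => [|q y Qq _]; last by rewrite (lifts_comm _ le).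
have [V [XV XgV]] := cantor_group_expands hvalid hbounded m0 (adm_base _) Gg.
apply: (cantor_groupI (U_expands aY (spread_expands XV))).
rewrite (_ : e @` _ = spread (g @` V)).
  exact: U_expands aY (spread_expands XgV).
have eq q v : Q q -> e (q (iota v)) = q (iota (g v)).
  by move=> Qq; rewrite (lifts_comm _ le) // (lifts_iota _ le).
apply/seteqP; split=> u.
  case=> v [[Yv Pv] <-|[q Qq [_ [w Vw <-] <-]] <-]; first by left; rewrite eN.
  right; exists q => //; exists (iota (g w)); last by rewrite eq.
  by exists (g w) => //; exists w.
case=> [[Yu Pu]|[q Qq [_ [_ [v Vv <-] <-] <-]]].
  by exists u; [left|rewrite eN].
exists (q (iota v)); last by rewrite eq.
by right; exists q => //; exists (iota v) => //; exists v.
Qed.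

(** For [v] below [P], [q] moves [v] below a representative and [q'] moves [h (q v)] below one. Both
    results have the same image under [pi], which is injective there, so they coincide and [h v] is
    a translate of [v]. *)
Lemma projection_kernel (h : aut U) : component_group Y T j h ->
  (forall u, pi (h (iota u)) = u) ->
  exists V, [/\ expands Y V, Q_fixed Q V &
    forall v, V v -> exists q : aut U, Q q /\ h v = q v].
Proof.
move=> [Ch hN] hpi; have [V [YV fV YhV]] := Cexpands Ch.
exists V; split=> // v Vv; have [y Yy yv] := expands_desc YV Vv.
have [Py|Py] := pselect (P y); last first.
  exists 1; split; first exact: subgroup1.
  exact: (hom_eq_desc (hom_aut h) (@hom_id _ U) (hN y Yy Py) yv).
have [q [Qq Vqv Sqv]] : exists q : aut U, [/\ Q q, V (q v) & descs Sr (q v)].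
  by apply: descs_translate => //; exists y.
have SrP u : descs Sr u -> descs P u.
  by case=> _ [k _ <-] ku; exists (s k).
have hqP := Pdescs Ch YhV Vqv (SrP _ Sqv).
have fhV : Q_fixed Q (h @` V).
  move=> q' Qq'; rewrite -image_autM (Ch.2 _ Qq') image_autM fV //.
have [|q' [Qq' _ Sq'v]] := descs_translate fhV _ hqP; first by exists (q v).
have E : q' (h (q v)) = q v.
  rewrite -(iota_pi (descs_gen Sq'v)) -[RHS](iota_pi (descs_gen Sqv)); congr iota.
  rewrite pi_q //; last exact: descs_gen.
  by rewrite -(pi_hom Ch (descs_gen (SrP _ Sqv))) hpi.
have QV := subgroupV hQ Qq; have QV' := subgroupV hQ Qq'.
(* Obtained by solving [q' (h (q v)) = q v] for [h v], with products acting from left to right. *)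
exists (q * q'^-1 * q^-1); split; first exact/(subgroupM hQ)/QV/(subgroupM hQ).
by rewrite !aut_mulE -E aut_VK -(centraliser_comm _ Ch Qq) aut_VK.
Qed.

Local Notation Hj :=
  (sub_group_of (component_subgroup hvalid hbounded r0 Y T (Q := Q) j) : groupType).

Lemma component_extension :
  exists Ki : groupType, locally_finite Ki /\ split_extension Ki Hj Gm.
Proof.
have /choice [p pP] : forall h : aut U, exists p : aut Um,
    C h -> forall u, p u = pi (h (iota u)).
  move=> h; have [Ch|Ch] := pselect (C h); last by exists 1 => /Ch.
  by have [p pE] := projection_exists Ch; exists p.
have pM h h' : C h -> C h' -> p (h * h') = p h * p h'.
  move=> Ch Ch'; apply: aut_eq => u.
  rewrite (pP _ (subgroupM SC Ch Ch')) !aut_mulE (pP _ Ch) (pP _ Ch') pi_hom //.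
  apply: (hom_gen (hom_aut h) _ (iota_gen u)) => _ [k _ <-].
  exact: Pgen.
have p1 : p 1 = 1.
  by apply: aut_eq => u; rewrite (pP _ (subgroup1 SC)) /= pi_iota.
have pV h : C h -> p h = 1 -> p h^-1 = 1.
  move=> Ch ph; have := pM _ _ Ch (subgroupV SC Ch).
  by rewrite mulgV p1 ph mul1g.
pose Ker : set (aut U) := [set h | component_group Y T j h /\ p h = 1].
have SH := component_subgroup hvalid hbounded r0 Y T (Q := Q) j.
have SKer : subgroup Ker.
  apply: subgroupI => [|h h' [Hh ph] [Hh' ph']|h [Hh ph]].
  - by split=> //; apply: subgroup1 SH.
  - split; first exact: (subgroupM SH).
    by rewrite (pM _ _ Hh.1 Hh'.1) ph ph' mulg1.
  - by split; [apply: (subgroupV SH)|apply: pV Hh.1 ph].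
exists (sub_group_of SKer : groupType); split.
  move=> S /finite_seqP [ss ES].
  have /choice [V VP] : forall x : sub_group_of SKer, exists V,
      [/\ expands Y V, Q_fixed Q V &
      forall v, V v -> exists q : aut U, Q q /\ sub_val x v = q v].
    move=> x; have [Hx px] := sub_valP x; apply: projection_kernel => // u.
    by rewrite -(pP _ Hx.1) px.
  (* Finitely many generators of a subgroup of the kernel share one expansion [W] on which each acts
     pointwise like elements of [Q]. *)
  have [|W [YW fW VW]] :=
    fixed_expansion hbounded r0 hQ hQfin aY fY (s := [seq V x | x <- ss]).
    by move=> _ /mapP [x _ ->]; case: (VP x).
  (* The condition [L] cuts out a finite set by [finite_aut_set], and within the kernel it is closed
     under the group operations, so the subgroup generated stays inside. *)
  pose L (h : aut U) := forall v, W v -> exists q : aut U, Q q /\ h v = q v.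
  pose LK : set (sub_group_of SKer) := [set x | L (sub_val x)].
  have finLK : finite_set LK.
    have fin_image : finite_set (@sub_val _ Ker @` LK).
      apply: (@finite_aut_set _ _ W Q) => //.
      - exact: U_finite (U_expands aY YW).
      - by case: (U_basis (U_expands aY YW)).
      - by move=> _ [x Lx <-].
    rewrite (eq_finite_set (B := @sub_val _ Ker @` LK)) //.
    by apply/card_esym/inj_card_eq => x y _ _; apply: sub_val_inj.
  apply: sub_finite_set finLK; apply: smallest_sub.
    apply: subgroupI => [v Wv|x y Lx Ly v Wv|x Lx v Wv].
    - by exists 1; split=> //; apply: subgroup1.
    - have [q [Qq Eq]] := Lx v Wv; have [q' [Qq' Eq']] := Ly v Wv.
      (* The factors appear in reverse: [y (x v) = y (q v) = q (y v) = q (q' v)]. *)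
      exists (q' * q); split; first exact: subgroupM.
      rewrite sub_valM !aut_mulE Eq -Eq' (centraliser_comm _ _ Qq) //.
      by case: (sub_valP y) => -[].
    - have [q [Qq Eq]] := Lx v Wv; exists q^-1; split; first exact: subgroupV.
      have Cx : C (sub_val x) by case: (sub_valP x) => -[].
      have QV := subgroupV hQ Qq; apply: (@aut_inj _ _ (sub_val x)).
      rewrite -(centraliser_comm _ Cx QV) Eq aut_VK.
      exact: (aut_KV (sub_val x)).
  (* [v] descends from some [y] in [V x], and agreement of [x] with an element of [Q] at [y] passes
     to descendants. *)
  move=> x Sx v Wv; have [YV fV Vx] := VP x.
  have [|y Vy yv] := expands_desc (VW (V x) _) Wv.
    by apply: map_f; move: Sx; rewrite ES.
  have [q [Qq Eq]] := Vx y Vy; exists q; split=> //.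
  exact: (hom_eq_desc (hom_aut _) (hom_aut q) Eq yv).
(* Lifts are unique, so the chosen ones multiply correctly and provide the section. *)
have /choice [l lP] : forall g : aut Um, exists h : aut U, lifts g h := lift_exists.
have lM g g' : l (g * g') = l g * l g'.
  apply: aut_eq => u.
  exact: (congr1 (@^~ u) (lifts_uniq (lP (g * g')) (lifts_comp (lP g) (lP g')))).
have pl g : Gm g -> p (l g) = g.
  move=> Gg; have [Cl _] := lift_component (lP g) Gg.
  by apply: aut_eq => u; rewrite (pP _ Cl) (lifts_iota _ (lP g)) pi_iota.
pose inc (x : sub_group_of SKer) : Hj :=
  SubElt (S := component_group Y T j) (sub_valP x).1.
have incM : {morph inc : x y / x * y} by move=> x y; apply: sub_val_inj.
pose pr (x : Hj) : aut Um := p (sub_val x).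
have prM : {morph pr : x y / x * y}.
  by move=> x y; apply: pM; [case: (sub_valP x)|case: (sub_valP y)].
pose sec (g : aut Um) : Hj := if pselect (Gm g) is left Gg
  then SubElt (S := component_group Y T j) (lift_component (lP g) Gg) : Hj else 1.
have secE g : Gm g -> sub_val (sec g) = l g.
  by rewrite /sec; case: pselect.
exists (multiplicative_of incM), (multiplicative_of prM), sec; split.
- by move=> x y /(congr1 (@sub_val _ _)) /= /sub_val_inj.
- move=> h; split=> [ph|[x _ <-]]; last by case: (sub_valP x).
  by exists (SubElt (S := Ker) (conj (sub_valP h) ph)) => //; apply: sub_val_inj.
- apply/seteqP; split=> [_ [h _ <-]|g Gg].
    have [Ch _] := sub_valP h.
    exact: projection_cantor_group Ch (pP _ Ch).
  by exists (sec g) => //=; rewrite /pr secE // pl.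
- move=> g g' Gg Gg'; apply: sub_val_inj.
  have Ggg' := subgroupM (cantor_group_subgroup hvalid hbounded m0) Gg Gg'.
  by rewrite sub_valM !secE.
- by move=> g Gg /=; rewrite /pr secE // pl.
Qed.

End Extension.

(** Serves the types with no orbit, where the trivial group [hT] is its own kernel. *)
Lemma trivial_split_extension (hT gT : groupType) (G : set gT) :
  (forall h : hT, h = 1) -> (forall g : gT, g = 1 /\ G g) ->
  split_extension hT hT G.
Proof.
move=> h1 g1.
exists (multiplicative_of (f := @id hT) (fun _ _ => erefl)).
exists (multiplicative_of (f := fun _ : hT => 1 : gT)
          (fun _ _ => esym (mulg1 1))).
exists (fun=> 1); split=> //.
- apply/seteqP; split=> g _; first by case: (g1 g) => _ Gg.
  by exists 1 => //; rewrite (g1 g).1.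
- by move=> g _; rewrite [RHS](g1 g).1.
Qed.

Theorem theorem4p4 (K : colours) (S2 : laws2 K) (r : nat) (hr : (0 < r)%N)
    (hvalid : forall m, (0 < m)%N -> valid S2 m)
    (hbounded : forall m, (0 < m)%N -> bounded S2 m)
    (Q : set (aut (cantor S2 r))) (hQ : subgroup Q)
    (hQG : Q `<=` @cantor_group K S2 r) (hQfin : finite_set Q)
    (t : nat) (T : 'I_t -> qset Q) (hT : transitive_types T)
    (rr : 'I_t -> nat) (hpi : is_pi T rr) :
  exists H : 'I_t -> groupType,
    isomorphic_to (centraliser (@cantor_group K S2 r) Q) (dprod_group H) /\
    forall i : 'I_t,
      (rr i = 0%N -> forall h : H i, h = 1) /\
      exists K_i : groupType,
        locally_finite K_i /\
        split_extension K_i (H i) (@cantor_group K S2 (rr i)).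
Proof.
have [_ [Y [aY fY cardY]]] := hpi.
exists (fun j => sub_group_of (component_subgroup hvalid hbounded hr Y T j)).
split; first exact: centraliser_isomorphic.
move=> j; have [s [sP s_stab s_orbit s_uniq]] :=
  orbit_representatives hQ hT fY (cardY j).
(* With no orbit of type [j], the part of that type is empty and its component group fixes all of
   the basis [Y]. *)
have H1 : rr j = 0%N ->
    forall h : sub_group_of (component_subgroup hvalid hbounded hr Y T j), h = 1.
  move=> rj0 h; apply: sub_val_inj; apply: aut_eq => u.
  have [_ hN] := sub_valP h.
  have /(congr1 (@^~ u)) // : sub_val h = id :> (cantor S2 r -> cantor S2 r).
  apply: (hom_ext aY (hom_aut _) (@hom_id _ _)) => y Yy; apply: hN => // -[_ ty].
  by have [k _] := s_orbit y Yy ty; case: k => k; rewrite rj0.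
split=> //; have [rj0|m0] := posnP (rr j).
  eexists; split; first exact: locally_finite_trivial (H1 rj0).
  apply: trivial_split_extension; first exact: H1.
  by rewrite rj0; apply: cantor0_group.
have [iota [iotaH iotaE]] := cantor_extend s (@cantor_model K S2 r).
(* [f] sends every translate of [s k] to the generator of index [k], unambiguously by [s_uniq];
   elsewhere the default is the first generator, which exists since [rr j] is positive. *)
have /choice [f fP] : forall u, exists x : cantor S2 (rr j),
    forall k (q : aut (cantor S2 r)), Q q -> u = q (s k) -> x = var S2 k.
  move=> u; have [[k [q [Qq E]]]|N] :=
    pselect (exists k (q : aut (cantor S2 r)), Q q /\ u = q (s k)).
    exists (var S2 k) => l q' Qq' E'; congr var.
    apply: (s_uniq k l (q * q'^-1)); first exact/(subgroupM hQ)/(subgroupV hQ).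
    by rewrite aut_mulE -E E' aut_VK.
  by exists (var S2 (Ordinal m0)) => k q Qq E; case: N; exists k, q.
have [free _] := U_basis aY.
have [pi [piH pif]] := free _ (@cantor_model K S2 (rr j)) f.
apply: (component_extension hvalid hbounded hr hQ hQfin aY fY hT m0
  sP s_stab _ s_uniq iotaH piH iotaE) => [y [Yy ty]|k q Qq].
  exact: s_orbit.
by rewrite pif; [exact: fP Qq erefl|apply: (Q_fixed_mem fY); case: (sP k)].
Qed.
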